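(* Let $d>1$ be an integer, $\lambda=(d-1)/2$, and let $(B_t)_{t\ge0}$ be the spherical Brownian motion on $\mathbb{S}_d$ with start at $\eta\in\mathbb{S}_d$. For $t>0$ let $$\beta^\lambda(t):=\sum_{n=1}^\infty\Bigl(1+\frac n\lambda\Bigr)\frac{(2\lambda)_n}{n!}\,e^{-n(n+2\lambda)t/2}$$ and $$\mathrm{br}^\lambda_t(n):=\beta^\lambda(t)^{-1}\Bigl(1+\frac n\lambda\Bigr)\frac{(2\lambda)_n}{n!}\,e^{-n(n+2\lambda)t/2},\quad n\in\mathbb{N}.$$ Further, let $t_0^\lambda$ be the unique solution of the equation $\beta^\lambda(t)=1$. Then, for $t\ge t_0^\lambda$, the distribution $\mathcal{L}(B_t)$ of $B_t$ satisfies $$\mathcal{L}(B_t)=(1-\beta^\lambda(t))\,\mathrm{unif}(\mathbb{S}_d)+\beta^\lambda(t)\sum_{n=1}^\infty\mathrm{br}^\lambda_t(n)\,\Delta^\lambda_{n,\eta}.$$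
   Context: $\mathbb{S}_d=\{x\in\mathbb{R}^{d+1}:\|x\|=1\}$ with uniform distribution $\mathrm{unif}(\mathbb{S}_d)$; $\eta^{t}x$ is the Euclidean inner product; $(\alpha)_n=\Gamma(\alpha+n)/\Gamma(\alpha)$; $\mathbb{N}=\{1,2,\dots\}$. Spherical Brownian motion is the diffusion on $\mathbb{S}_d$ with generator one half of the Laplace--Beltrami operator. For $\lambda>0$, $D_n^\lambda=C_n^\lambda/C_n^\lambda(1)$ with $C_n^\lambda$ the Gegenbauer (ultraspherical) polynomial of degree $n$, $C_n^\lambda(1)=(2\lambda)_n/n!$. For $n\in\mathbb{N}$, $\Delta^\lambda_{n,\eta}$ is the probability distribution on $\mathbb{S}_d$ with $\mathrm{unif}(\mathbb{S}_d)$-density $x\mapsto1+D_n^\lambda(\eta^{t}x)$. *)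

(* Defs.v *)
From HB Require Import structures.
From mathcomp Require Import all_boot all_order all_algebra.
From mathcomp Require Import all_classical all_reals all_analysis.

Set Implicit Arguments.
Unset Strict Implicit.
Unset Printing Implicit Defensive.

Import Order.TTheory GRing.Theory Num.Theory.
Import numFieldNormedType.Exports.

Local Open Scope classical_set_scope.
Local Open Scope ring_scope.

Section Gegenbauer.
Context {R : realType}.
Implicit Types (a l t x : R) (n : nat).

Definition Gamma a : R :=
  \int[lebesgue_measure]_(x in `]0, +oo[) (x `^ (a - 1) * expR (- x)).

Definition poch a n : R := Gamma (a + n%:R) / Gamma a.

(* The three-term recurrence
   n C_n(X) = 2 (n + l - 1) X C_(n-1)(X) - (n + 2 l - 2) C_(n-2)(X). *)
Fixpoint gegenbauer l n : {poly R} :=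
  match n with
  | 0 => 1
  | 1 => (2 * l) *: 'X
  | (k.+1 as m).+1 =>
      (k.+2%:R)^-1 *: ((2 * (k.+1%:R + l)) *: ('X * gegenbauer l m)
                       - (k%:R + 2 * l) *: gegenbauer l k)
  end.

Definition gegenbauer_norm l n x : R :=
  (gegenbauer l n).[x] / (gegenbauer l n).[1].

Definition beta_term l t n : R :=
  (1 + n%:R / l) * (poch (2 * l) n / n`!%:R)
  * expR (- (n%:R * (n%:R + 2 * l) * t / 2)).

Definition beta l t : R :=
  limn (fun N : nat => \sum_(1 <= n < N) beta_term l t n).

Definition br l t n : R := (beta l t)^-1 * beta_term l t n.

End Gegenbauer.

Section Sphere.
Context {R : realType} {d : nat}.
Local Notation E := 'rV[R]_d.+1.
Implicit Types (x y eta : E) (f : E -> R).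

Definition dot x y : R := (x *m y^T) 0 0.

(* The library norm on row vectors is the sup norm. *)
Definition enorm x : R := Num.sqrt (dot x x).

Definition sphere : set E := [set x | enorm x = 1].

(* R^(d+1) with its Borel sigma-algebra. *)
Definition borelE := g_sigma_algebraType (@open E).

(* The uniform distribution on the sphere is the unique probability measure
   carried by the sphere and invariant under all orthogonal transformations
   (acting on the right, since vectors are rows). *)
Definition is_unif_sphere (mu : probability borelE R) : Prop :=
  mu sphere = 1%E /\
  forall Q : 'M[R]_d.+1, Q *m Q^T = 1%:M ->
    forall A : set borelE, measurable A ->
      mu ((fun x : E => x *m Q) @^-1` A) = mu A.

Definition Delta (mu : probability borelE R) (l : R) (n : nat) eta
    (A : set borelE) : \bar R :=
  (\int[mu]_(x in A) (1 + gegenbauer_norm l n (dot eta x))%:E)%E.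

(* A function on the sphere is given by any function f on R^(d+1); the
   definitions below only use its degree-0 homogeneous extension, hence only
   the values of f on the sphere. *)
Definition homog_ext f : E -> R := fun y => f ((enorm y)^-1 *: y).

(* f is C^infinity on the sphere: all iterated partial derivatives of its
   extension exist and are differentiable away from the origin. *)
Definition smooth_sphere f : Prop :=
  forall (vs : seq E) y, y != 0 ->
    differentiable (foldr (fun v (g : E -> R) => 'D_v g) (homog_ext f) vs) y.

(* Laplace-Beltrami operator: the restriction to the sphere of the Euclidean
   Laplacian of the degree-0 homogeneous extension. *)
Definition laplace_beltrami f x : R :=
  \sum_(i < d.+1)
    'D_(delta_mx 0 i : E) ('D_(delta_mx 0 i : E) (homog_ext f)) x.

End Sphere.
Arguments borelE : clear implicits.
Arguments sphere : clear implicits.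

Section Process.
Context {R : realType} {dT : measure_display} {T : measurableType dT}.

(* Time ranges over [0, +oo[; the last condition is
   E[M t | F s] = M s almost surely, written without conditional
   expectations. *)
Definition martingale (P : probability T R) (F : R -> set (set T))
    (M : R -> T -> R) : Prop :=
  [/\ forall t, 0 <= t -> forall Y : set R, measurable Y -> F t (M t @^-1` Y),
      forall t, 0 <= t -> P.-integrable setT (EFin \o M t) &
      forall s t, 0 <= s -> s <= t -> forall A, F s A ->
        \int[P]_(w in A) M t w = \int[P]_(w in A) M s w].

Context {d : nat}.
Local Notation E := 'rV[R]_d.+1.

Definition natural_filtration (B : R -> T -> E) (s : R) : set (set T) :=
  <<s \bigcup_(u in `[0, s])
        preimage_set_system setT (B u : T -> borelE R d) measurable >>.

(* Diffusion on the sphere with generator (1/2) laplace_beltrami, started at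
   eta, in the sense of the martingale problem (Stroock-Varadhan,
   Ikeda-Watanabe) with the smooth functions as domain. *)
Record spherical_brownian_motion (P : probability T R) (eta : E)
    (B : R -> T -> E) : Prop := {
  sbm_measurable : forall t, 0 <= t ->
    measurable_fun setT (B t : T -> borelE R d) ;
  sbm_sphere : forall t w, 0 <= t -> sphere R d (B t w) ;
  sbm_continuous : forall w, {within `[0, +oo[, continuous (fun t => B t w)} ;
  sbm_start : P [set w | B 0 w = eta] = 1%E ;
  sbm_generator : forall f : E -> R, smooth_sphere f ->
    martingale P (natural_filtration B) (fun t w =>
      f (B t w) - f (B 0 w)
      - \int[lebesgue_measure]_(s in `[0, t])
          (2^-1 * laplace_beltrami f (B s w)))
}.

End Process.

(* Main.v *)
From HB Require Import structures.
Require Import Defs.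
From mathcomp Require Import all_boot all_order all_algebra.
From mathcomp Require Import all_classical all_reals all_analysis.
From mathcomp Require Import measurable_realfun.
From mathcomp Require Import ring lra zify.
Import Order.TTheory GRing.Theory Num.Theory.
Import numFieldNormedType.Exports.
Local Open Scope classical_set_scope.
Local Open Scope ring_scope.

(* The functions [x |-> C_n(v . x)], [v] on the sphere, are eigenfunctions of the
   Laplace-Beltrami operator, so the martingale problem turns
   [u(t) = E C_n(v . B_t)] into a solution of [u' = - n (n + 2 lam) / 2 u], i.e.
     E C_n(v . B_t) = exp (- n (n + 2 lam) t / 2) C_n(v . eta).
   The law of [B_t] is recovered from these identities without any theory of
   spherical harmonics. The polynomials [K_k(s)] proportional to [s^(2k) (1 + s)]
   are an approximate identity on the sphere, hence for [f] continuous
     E f(B_t) = lim_k \int f(v) E K_k(v . B_t) unif(dv).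
   The Gegenbauer polynomials are orthogonal for the distribution of a coordinate
   under [unif], and as [K_k] concentrates at [1], its coefficient along [C_n] tends to
   [C_n(1) / |C_n|^2 = 1 + n / lam]. So [E K_k(v . B_t)] converges uniformly in [v] to
     \sum_n (1 + n / lam) exp (- n (n + 2 lam) t / 2) C_n(eta . v),
   which is therefore the density of the law of [B_t]. The mixture is a rearrangement
   of this series, because [C_n(1) = (2 lam)_n / n!]. All that is needed about [unif]
   is a recursion for the moments of a coordinate, obtained from invariance. *)

Set Implicit Arguments.
Unset Strict Implicit.
Unset Printing Implicit Defensive.

(** * Gegenbauer polynomials *)

Section GegenbauerTheory.
Context {R : realType}.
Implicit Types (l s t x : R) (n : nat).
Local Notation C := gegenbauer.

(** All error estimates are reduced to one quantity, the mean of 1 - s under K_k. For this reason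
    C_n(s) - C_n(1) and, up to an arbitrarily small constant, the oscillation of a continuous
    function are both bounded linearly in 1 - s. The shape of K_k makes that mean explicit: the even
    power peaks at both ends of [-1, 1], the factor 1 + s removes the peak at -1, and (1 - s)(1 + s)
    = 1 - s^2 leaves a difference of consecutive even moments. The density of a coordinate,
    proportional to (1 - s^2)^(l - 1/2), never appears: the moment recursion is restated as an
    integration by parts on polynomials, from which orthogonality and norms follow algebraically.
    The bounds on C_n may be as crude as r^n because exp(- n^2 t / 2) beats every geometric rate.
    The errors in the coefficients of K_k can then be summed over n, uniformly in v. *)

Lemma gegenbauerSS l n :
  (n.+2%:R)%:P * C l n.+2 =
    (2 * (n.+1%:R + l))%:P * ('X * C l n.+1) - (n%:R + 2 * l)%:P * C l n.
Proof.
rewrite [C l n.+2]/= -/(C l n.+1) -!mul_polyC [LHS]mulrA -polyCM.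
by rewrite mulfV ?pnatr_eq0// mul1r.
Qed.

Lemma deriv_mulC (c : R) (p : {poly R}) : (c%:P * p)^`() = c%:P * p^`().
Proof. by rewrite !mul_polyC derivZ. Qed.

Lemma deriv_mulX (p : {poly R}) : ('X * p)^`() = p + 'X * p^`().
Proof. by rewrite derivM derivX mul1r. Qed.

Lemma natr_poly_inj n (p q : {poly R}) : n.+1%:R * p = n.+1%:R * q -> p = q.
Proof.
apply: mulfI.
by rewrite -(polyC_natr R n.+1) polyC_eq0 pnatr_eq0.
Qed.

Lemma deriv_poly1 : (1 : {poly R})^`() = 0.
Proof. by rewrite -polyC1 derivC. Qed.

(** The two identities need each other: differentiating the recurrence and eliminating C_n' by the
    second one gives the first at n + 1, after which the second at n + 1 is algebra. *)
Lemma deriv_gegenbauer_rec l n :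
  (C l n.+1)^`() = 'X * (C l n)^`() + (n%:R + 2 * l%:P) * C l n /\
  'X * (C l n.+1)^`() = (C l n)^`() + n.+1%:R * C l n.+1.
Proof.
elim: n => [|n [IH1 IH2]].
  rewrite /= derivZ derivX deriv_poly1 -!mul_polyC polyCM polyC_natr.
  by split; ring.
have IH1' : (n%:R + 2 * l%:P) * C l n = (C l n.+1)^`() - 'X * (C l n)^`().
  by rewrite IH1; ring.
have IH2' : (C l n)^`() = 'X * (C l n.+1)^`() - n.+1%:R * C l n.+1.
  by rewrite IH2; ring.
have rec' : n.+2%:R * (C l n.+2)^`() =
    2 * (n.+1%:R + l%:P) * (C l n.+1 + 'X * (C l n.+1)^`())
    - (n%:R + 2 * l%:P) * (C l n)^`().
  have /(congr1 (@deriv R)) := gegenbauerSS l n.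
  rewrite derivB !deriv_mulC deriv_mulX.
  by rewrite !(polyCM, polyCD, polyC_natr).
have E1 : (C l n.+2)^`() = 'X * (C l n.+1)^`() + (n.+1%:R + 2 * l%:P) * C l n.+1.
  apply: (@natr_poly_inj n.+1); rewrite rec' IH2'.
  by ring.
split=> //.
rewrite E1 -(polyC_natr R n.+2) gegenbauerSS !(polyCM, polyCD, polyC_natr) IH1' IH2'.
by ring.
Qed.

(** The two derivative identities give (1 - X^2) C_(n+1)' = (n + 2 l) C_n - (n + 1) X C_(n+1).
    Differentiating once more and eliminating C_n and C_n' leaves an equation in C_(n+1) alone. *)
Lemma gegenbauer_ode l n :
  (1 - 'X ^+ 2) * (C l n)^`()^`() - (2 * l + 1)%:P * ('X * (C l n)^`())
  = - (n%:R * (n%:R + 2 * l))%:P * C l n.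
Proof.
case: n => [|n]; first by rewrite /= deriv_poly1 linear0 !mul0r polyC0; ring.
have [E1 E2] := deriv_gegenbauer_rec l n.
have E : (1 - 'X ^+ 2) * (C l n.+1)^`() =
    (n%:R + 2 * l)%:P * C l n - (n.+1%:R)%:P * ('X * C l n.+1).
  transitivity ((C l n.+1)^`() - 'X * ('X * (C l n.+1)^`())); first by ring.
  by rewrite E2 [in X in X - _]E1 !(polyCM, polyCD, polyC_natr); ring.
have /(congr1 (@deriv R)) := E.
rewrite derivM derivB deriv_poly1 derivXn [2.-1]/= derivB !deriv_mulC deriv_mulX.
rewrite !(polyCM, polyCD, polyC_natr, polyCN) => H.
have E2' : (C l n)^`() = 'X * (C l n.+1)^`() - n.+1%:R * C l n.+1 by rewrite E2; ring.
move: H; rewrite E2' !polyC1 expr1 => /eqP H.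
rewrite -subr_eq0 in H; move/eqP in H.
apply/eqP; rewrite -subr_eq0; apply/eqP; rewrite -[RHS]H.
ring.
Qed.


Lemma gegenbauer0 l : C l 0 = 1.
Proof. by []. Qed.

Lemma gegenbauer1 l : C l 1 = (2 * l) *: 'X.
Proof. by []. Qed.

#[local] Arguments gegenbauer : simpl never.

Lemma horner_gegenbauerSS l n x :
  n.+2%:R * (C l n.+2).[x] =
    2 * (n.+1%:R + l) * (x * (C l n.+1).[x]) - (n%:R + 2 * l) * (C l n).[x].
Proof.
have /(congr1 (horner ^~ x)) /= := gegenbauerSS l n.
by rewrite !(hornerD, hornerN, hornerM, hornerC, hornerX).
Qed.

(** At X = 1 both derivative identities compute C_(n+1)'(1) - C_n'(1). Their comparison is the
    recursion satisfied by (2 l)_n / n!. *)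
Lemma gegenbauer_at1 l n : n.+1%:R * (C l n.+1).[1] = (n%:R + 2 * l) * (C l n).[1].
Proof.
have [E1 E2] := deriv_gegenbauer_rec l n.
move/(congr1 (horner ^~ 1)): E2; rewrite E1 /=.
rewrite -!(polyC_natr R) -!polyCM -polyCD.
rewrite !(hornerD, hornerM, hornerX, hornerC) !mul1r.
by move=> /addrI ->.
Qed.

(** For 2 l >= 1, that is d >= 2, the ratio (n + 2 l) / (n + 1) of consecutive values at 1 is at
    least 1. Later estimates can then divide by C_n(1) without loss. *)
Lemma gegenbauer_at1_ge1 l n : 1 <= 2 * l -> 1 <= (C l n).[1].
Proof.
move=> hl; elim: n => [|n IH]; first by rewrite hornerC.
rewrite -(@ler_pM2l _ n.+1%:R) ?ltr0n// mulr1 gegenbauer_at1 -natr1.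
have n0 : (0 : R) <= n%:R by [].
nra.
Qed.

(* Crude geometric bounds: they are only used against the Gaussian decay in [n]
   of the heat coefficients. *)
Lemma gegenbauer_bounds l n s : 0 <= l -> `|s| <= 1 ->
  `|(C l n).[s]| <= (5 + 6 * l) ^+ n /\
  `|(C l n).[s] - (C l n).[1]| <= (5 + 6 * l) ^+ n * (1 - s).
Proof.
(* The value of r serves the difference estimate, whose induction step needs 4 (m + 1 + l) r + m + 2
   l <= (m + 2) r^2. *)
move=> l0 s1; set r := 5 + 6 * l.
have r1 : 1 <= r by rewrite /r; lra.
have s1' : 0 <= 1 - s by rewrite subr_ge0 (le_trans (ler_norm _)).
have bound m x : `|x| <= 1 ->
    `|(C l m).[x]| <= r ^+ m /\ `|(C l m.+1).[x]| <= r ^+ m.+1.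
  move=> x1; elim: m => [|m [IH1 IH2]].
    rewrite gegenbauer0 gegenbauer1 hornerC normr1 lexx hornerZ hornerX normrM.
    split=> //; rewrite ger0_norm; last by lra.
    have : 2 * l * `|x| <= 2 * l * 1 by rewrite ler_wpM2l//; lra.
    rewrite expr1 /r; lra.
  split=> //.
  have m0 : (0 : R) <= m%:R by [].
  rewrite -(@ler_pM2l _ m.+2%:R) ?ltr0n// -{1}(@ger0_norm R m.+2%:R)// -normrM.
  rewrite horner_gegenbauerSS.
  apply: (le_trans (ler_normB _ _)); rewrite !normrM.
  rewrite (@ger0_norm _ 2)// (@ger0_norm _ (_ + l)) ?addr_ge0//.
  rewrite (@ger0_norm _ (_ + 2 * _)); last by rewrite addr_ge0// mulr_ge0.
  have rm : 0 <= r ^+ m by rewrite exprn_ge0//; lra.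
  have A1 : `|x| * `|(C l m.+1).[x]| <= r * r ^+ m.
    by rewrite -[leRHS]mul1r -exprS ler_pM.
  have A1' : 2 * (m.+1%:R + l) * (`|x| * `|(C l m.+1).[x]|) <=
             2 * (m.+1%:R + l) * (r * r ^+ m).
    by rewrite ler_wpM2l// mulr_ge0// addr_ge0.
  have A2' : (m%:R + 2 * l) * `|(C l m).[x]| <= (m%:R + 2 * l) * r ^+ m.
    by rewrite ler_wpM2l// addr_ge0// mulr_ge0.
  have A3 : 2 * (m.+1%:R + l) * r + (m%:R + 2 * l) <= m.+2%:R * (r * r).
    rewrite -2!natr1 -natr1 /r; nra.
  have A4 := ler_wpM2r rm A3.
  rewrite 2!exprS; lra.
have b1 m : `|(C l m).[1]| <= r ^+ m.
  by have [] := bound m 1; rewrite ?normr1.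
split; first by have [] := bound n s s1.
suff : `|(C l n).[s] - (C l n).[1]| <= r ^+ n * (1 - s) /\
       `|(C l n.+1).[s] - (C l n.+1).[1]| <= r ^+ n.+1 * (1 - s) by case.
elim: n => [|m [IH1 IH2]].
  rewrite gegenbauer0 gegenbauer1 !(hornerZ, hornerX, hornerC) subrr normr0 expr0 mul1r.
  split=> //; rewrite -normrN opprB.
  rewrite (_ : 2 * l * 1 - _ = 2 * l * (1 - s)); last by ring.
  rewrite ger0_norm ?mulr_ge0//.
  by rewrite ler_wpM2r// expr1 /r; lra.
split=> //.
have m0 : (0 : R) <= m%:R by [].
rewrite -(@ler_pM2l _ m.+2%:R) ?ltr0n// -{1}(@ger0_norm R m.+2%:R)// -normrM.
rewrite mulrBr !horner_gegenbauerSS.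
set a := (C l m.+1).[s]; set b := (C l m.+1).[1] in IH2 *.
set c := (C l m).[s]; set d := (C l m).[1] in IH1 *.
(* Replacing the multiplier s by 1 costs [(1 - s) * b], which already carries the factor 1 - s. *)
have -> : 2 * (m.+1%:R + l) * (s * a) - (m%:R + 2 * l) * c
   - (2 * (m.+1%:R + l) * (1 * b) - (m%:R + 2 * l) * d)
  = 2 * (m.+1%:R + l) * (s * (a - b) - (1 - s) * b) - (m%:R + 2 * l) * (c - d).
  by ring.
apply: (le_trans (ler_normB _ _)); rewrite !normrM.
rewrite (@ger0_norm _ 2)// (@ger0_norm _ (_ + l)) ?addr_ge0//.
rewrite (@ger0_norm _ (_ + 2 * _)); last by rewrite addr_ge0// mulr_ge0.
have rm : 0 <= r ^+ m by rewrite exprn_ge0//; lra.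
have A1 : `|s * (a - b) - (1 - s) * b| <= 2 * (r * r ^+ m * (1 - s)).
  apply: (le_trans (ler_normB _ _)); rewrite mulr_natl mulr2n -exprS lerD//.
    by rewrite normrM -[leRHS]mul1r ler_pM.
  rewrite normrM [leRHS]mulrC ger0_norm// ler_wpM2l//.
  exact: b1.
have A1' : 2 * (m.+1%:R + l) * `|s * (a - b) - (1 - s) * b| <=
           2 * (m.+1%:R + l) * (2 * (r * r ^+ m * (1 - s))).
  by rewrite ler_wpM2l// mulr_ge0// addr_ge0.
have A2' : (m%:R + 2 * l) * `|c - d| <= (m%:R + 2 * l) * (r ^+ m * (1 - s)).
  by rewrite ler_wpM2l// addr_ge0// mulr_ge0.
have A3 : 4 * (m.+1%:R + l) * r + (m%:R + 2 * l) <= m.+2%:R * (r * r).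
  rewrite -2!natr1 -natr1 /r; nra.
have A4 := ler_wpM2r (mulr_ge0 rm s1') A3.
rewrite 2!exprS; lra.
Qed.

(** The span contains 1 and is stable under multiplication by X: the recurrence, solved for X
    C_(n+1), expresses it by C_(n+2) and C_n, the divisor 2 (n + 1 + l) being nonzero for l > 0. *)
Lemma gegenbauer_span l (p : {poly R}) : 0 < l ->
  exists (N : nat) (b : nat -> R), p = \sum_(n < N) b n *: C l n.
Proof.
move=> l0.
pose S p := exists (N : nat) (b : nat -> R), p = \sum_(n < N) b n *: C l n.
have S0 : S 0 by exists 0%N, (fun=> 0); rewrite big_ord0.
have SC n : S (C l n).
  exists n.+1, (fun i => (i == n)%:R).
  rewrite (bigD1 ord_max)//= eqxx scale1r big1 ?addr0// => i.
  by rewrite -val_eqE /= => /negbTE ->; rewrite scale0r.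
have SZ c q : S q -> S (c *: q).
  move=> [N [b ->]]; exists N, (fun n => c * b n).
  by rewrite scaler_sumr; apply: eq_bigr => i _; rewrite scalerA.
have SD q1 q2 : S q1 -> S q2 -> S (q1 + q2).
  move=> [N1 [b1 ->]] [N2 [b2 ->]].
  exists (maxn N1 N2), (fun n =>
    (if (n < N1)%N then b1 n else 0) + (if (n < N2)%N then b2 n else 0)).
  under [RHS]eq_bigr do rewrite scalerDl.
  rewrite big_split /=; congr (_ + _).
    rewrite -(big_mkord xpredT (fun n => b1 n *: C l n)).
    rewrite -(big_mkord xpredT (fun n => (if (n < N1)%N then b1 n else 0) *: C l n)).
    rewrite (@big_cat_nat _ _ _ N1 0 (maxn N1 N2))//= ?leq_maxl//.
    rewrite [X in _ = _ + X]big_nat [X in _ = _ + X]big1 ?addr0.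
      by apply: eq_big_nat => i /andP[_ ->].
    by move=> i /andP[+ _]; rewrite leqNgt => /negbTE ->; rewrite scale0r.
  rewrite -(big_mkord xpredT (fun n => b2 n *: C l n)).
  rewrite -(big_mkord xpredT (fun n => (if (n < N2)%N then b2 n else 0) *: C l n)).
  rewrite (@big_cat_nat _ _ _ N2 0 (maxn N1 N2))//= ?leq_maxr//.
  rewrite [X in _ = _ + X]big_nat [X in _ = _ + X]big1 ?addr0.
    by apply: eq_big_nat => i /andP[_ ->].
  by move=> i /andP[+ _]; rewrite leqNgt => /negbTE ->; rewrite scale0r.
have SXC n : S ('X * C l n).
  case: n => [|n].
    rewrite (_ : 'X * _ = (2 * l)^-1 *: C l 1); first exact: SZ.
    rewrite gegenbauer1 gegenbauer0 scalerA mulVf ?scale1r ?mulr1//.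
    by rewrite mulf_neq0// ?pnatr_eq0// gt_eqF.
  rewrite (_ : 'X * _ = (2 * (n.+1%:R + l))^-1 *:
     (n.+2%:R *: C l n.+2 + (n%:R + 2 * l) *: C l n)).
    by apply/SZ/SD; apply/SZ.
  rewrite -(mul_polyC n.+2%:R) gegenbauerSS !mul_polyC subrK scalerA mulVf ?scale1r//.
  by rewrite mulf_neq0// ?pnatr_eq0// gt_eqF// ltr_wpDl.
rewrite -/(S p); elim/poly_ind: p => [//|p c [N [b ->]]].
apply: (SD); last by rewrite -[c%:P]mulr1 mul_polyC; apply/SZ/(SC 0).
rewrite mulr_suml.
elim: N => [|N IH]; first by rewrite big_ord0.
rewrite big_ord_recr /=; apply: SD => //.
by rewrite -scalerAl; apply: SZ; rewrite mulrC.
Qed.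

(** * Orthogonality and norms from an abstract integration by parts *)

Section Orthogonality.
Variables (l : R) (I : {scalar {poly R}}).
Hypothesis l0 : 0 < l.
Hypothesis I1 : I 1 = 1.
(** For the normalised weight (1 - s^2)^(l - 1/2) on [-1, 1], the argument of [I] times the weight
    is the derivative of (1 - s^2)^(l + 1/2) q, which vanishes at both ends. *)
Hypothesis I_ibp : forall q, I ((1 - 'X ^+ 2) * q^`() - (2 * l + 1) *: ('X * q)) = 0.

(** Integration by parts applied to the Wronskian C_n' C_m - C_n C_m' gives, by the differential
    equation, (e_m - e_n) I (C_n C_m) = 0, where e_k = k (k + 2 l) takes distinct values. *)
Lemma gegenbauer_ortho n m : n != m -> I (C l n * C l m) = 0.
Proof.
move=> nm.
pose e k : R := k%:R * (k%:R + 2 * l).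
have := I_ibp ((C l n)^`() * C l m - C l n * (C l m)^`()).
rewrite (_ : _ - _ *: _ = (e m - e n) *: (C l n * C l m)).
  rewrite linearZ => /eqP; rewrite mulf_eq0 => /orP[|/eqP//].
  have -> : e m - e n = (m%:R - n%:R) * (m%:R + n%:R + 2 * l) by rewrite /e; ring.
  rewrite mulf_eq0 subr_eq0 eqr_nat eq_sym (negbTE nm) /= gt_eqF//.
  by rewrite ltr_wpDl// mulr_gt0.
have On := gegenbauer_ode l n; have Om := gegenbauer_ode l m.
rewrite -!mul_polyC derivB !derivM polyCB.
transitivity (C l m * ((1 - 'X^2) * ((C l n)^`())^`() - (2 * l + 1)%:P * ('X * (C l n)^`()))
   - C l n * ((1 - 'X^2) * ((C l m)^`())^`() - (2 * l + 1)%:P * ('X * (C l m)^`()))).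
  by ring.
by rewrite On Om /e; ring.
Qed.

(** The recurrence for C_(n+2) paired with C_(n+2), and the one for C_(n+3) paired with C_(n+1),
    both reduce by orthogonality to the mixed moment I (X C_(n+1) C_(n+2)). Eliminating it yields
    the ratio of consecutive norms. *)
Lemma gegenbauer_sqnorm n : (n%:R + l) * I (C l n * C l n) = l * (C l n).[1].
Proof.
have IZ c p : I (c%:P * p) = c * I p by rewrite mul_polyC linearZ.
have IX2 : I ('X * 'X) * (2 * l + 2) = 1.
  have := I_ibp 'X.
  rewrite derivX mulr1 -expr2 -addrA -opprD raddfB /= raddfD /= linearZ I1 /=.
  lra.
suff : (n%:R + l) * I (C l n * C l n) = l * (C l n).[1] /\
       (n.+1%:R + l) * I (C l n.+1 * C l n.+1) = l * (C l n.+1).[1] by case.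
elim: n => [|n [IH1 IH2]].
  rewrite gegenbauer0 gegenbauer1 mulr1 I1 !(hornerZ, hornerX, hornerC) add0r; split=> //.
  rewrite -!mul_polyC (_ : _ * _ * _ = (2 * l * (2 * l))%:P * ('X * 'X)); last first.
    by rewrite [in RHS]polyCM; ring.
  rewrite IZ; move: IX2; set u := I _ => IX2.
  have -> : (1 + l) * (2 * l * (2 * l) * u) = l * (2 * l) * (u * (2 * l + 2)) by ring.
  by rewrite IX2 !mulr1.
split=> //.
have E1 : n.+2%:R * I (C l n.+2 * C l n.+2) =
    2 * (n.+1%:R + l) * I ('X * C l n.+1 * C l n.+2).
  have /(congr1 (fun p => I (p * C l n.+2))) := gegenbauerSS l n.
  rewrite -mulrA IZ => ->.
  rewrite mulrBl raddfB /= -!mulrA !IZ (@gegenbauer_ortho n) ?mulr0 ?subr0 ?mulrA//.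
  by rewrite neq_ltn leqnSn.
have E2 : (n.+1%:R + 2 * l) * I (C l n.+1 * C l n.+1) =
    2 * (n.+2%:R + l) * I ('X * C l n.+1 * C l n.+2).
  have /(congr1 (fun p => I (p * C l n.+1))) := gegenbauerSS l n.+1.
  rewrite -mulrA IZ gegenbauer_ortho ?mulr0; last first.
    by rewrite neq_ltn leqnSn orbT.
  rewrite mulrBl raddfB /= -!mulrA !IZ => /esym/eqP.
  rewrite subr_eq0 => /eqP <-.
  by rewrite !mulrA [_ * _ * C l n.+1]mulrAC.
have E3 := gegenbauer_at1 l n.+1.
have n2 : n.+2%:R != 0 :> R by rewrite pnatr_eq0.
apply: (mulfI n2).
move: IH2 E1 E2 E3; set u := I _; set v := I _; set w := I _.
set c := (_).[1]; set c' := (_).[1] => IH2 E1 E2 E3.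
have -> : n.+2%:R * ((n.+2%:R + l) * v) = (n.+2%:R + l) * (n.+2%:R * v) by ring.
have -> : n.+2%:R * (l * c') = l * (n.+2%:R * c') by ring.
rewrite E1 E3.
have -> : l * ((n.+1%:R + 2 * l) * c) = (n.+1%:R + 2 * l) * (l * c) by ring.
rewrite -IH2.
have -> : (n.+1%:R + 2 * l) * ((n.+1%:R + l) * u) = (n.+1%:R + l) * ((n.+1%:R + 2 * l) * u) by ring.
by rewrite E2; ring.
Qed.

End Orthogonality.

End GegenbauerTheory.

(** * Integrals against the uniform distribution *)

Lemma eq_poly_horner {R : realType} (p q : {poly R}) :
  (forall x, p.[x] = q.[x]) -> p = q.
Proof.
move=> pq; apply/eqP; rewrite -subr_eq0; apply/negPn/negP => pq0.
pose rs := [seq (i%:R : R) | i <- iota 0 (size (p - q))].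
suff : (size rs < size (p - q)%R)%N by rewrite size_map size_iota ltnn.
apply: max_poly_roots => //.
- by apply/allP => x _; rewrite rootE hornerD hornerN pq subrr.
- by rewrite map_inj_uniq ?iota_uniq// => i j /eqP; rewrite eqr_nat => /eqP.
Qed.

Section ProbabilityIntegral.
Context {dT : measure_display} {T : measurableType dT} {R : realType}.
Variable P : probability T R.

Lemma ae_bounded_integrable (f : T -> R) (M : R) :
  measurable_fun setT f -> {ae P, forall x, `|f x| <= M} ->
  P.-integrable setT (EFin \o f).
Proof.
move=> mf fM; apply/integrableP; split; first exact/measurable_EFinP.
apply: (@le_lt_trans _ _ (\int[P]_x `|M%:E|)%E).
  apply: ae_ge0_le_integral => //.
  - by apply: measurableT_comp => //; exact/measurable_EFinP.
  - apply: filterS fM => x fM _ /=.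
    by rewrite lee_fin (le_trans fM)// ler_norm.
rewrite integral_cst// [X in (_ * X)%E]probability_setT mule1.
by rewrite ltry.
Qed.

Lemma Rintegral_cst_probability (r : R) : \int[P]_x r = r.
Proof. by rewrite Rintegral_cst// [X in fine X]probability_setT mulr1. Qed.

Lemma ae_eq_Rintegral (f g : T -> R) : measurable_fun setT f ->
  measurable_fun setT g -> {ae P, forall x, f x = g x} ->
  \int[P]_x f x = \int[P]_x g x.
Proof.
move=> mf mg fg; congr fine; apply: ae_eq_integral => //.
- exact/measurable_EFinP.
- exact/measurable_EFinP.
- by apply: filterS fg => x -> _.
Qed.

Lemma sub_ae (A B : T -> Prop) : (forall x, A x -> B x) ->
  {ae P, forall x, A x} -> {ae P, forall x, B x}.
Proof. by move=> AB; apply: filterS. Qed.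

Lemma probability1_ae (A : set T) : measurable A -> P A = 1%E ->
  {ae P, forall x, A x}.
Proof.
move=> mA PA; exists (~` A); split => //; first exact: measurableC.
by rewrite probability_setC// PA subee.
Qed.

Lemma Rintegral_ord_sum (n : nat) (F : nat -> T -> R) :
  (forall i, P.-integrable setT (EFin \o F i)) ->
  \int[P]_x (\sum_(i < n) F i x) = \sum_(i < n) \int[P]_x F i x.
Proof.
move=> iF; elim: n => [|n IH].
  under eq_Rintegral do rewrite big_ord0.
  by rewrite Rintegral_cst_probability big_ord0.
under eq_Rintegral do rewrite big_ord_recr.
rewrite big_ord_recr /= RintegralD ?IH//.
rewrite (_ : _ \o _ = fun x => (\sum_(i < n) (EFin \o F i) x)%E).
  exact: integrable_sum.
by apply/funext => x /=; rewrite sumEFin.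
Qed.

Lemma ae_Rintegral_norm_le (f : T -> R) (M : R) : 0 <= M ->
  measurable_fun setT f -> {ae P, forall x, `|f x| <= M} ->
  `|\int[P]_x f x| <= M.
Proof.
move=> M0 mf fM; have intf := ae_bounded_integrable mf fM.
rewrite -lee_fin EFin_normr_Rintegral//.
have mEf : measurable_fun setT (EFin \o f) by exact/measurable_EFinP.
apply: (le_trans (le_abse_integral _ measurableT mEf)).
have := @integral_le_bound _ _ _ P setT (EFin \o f) M%:E measurableT mEf.
rewrite [X in (_ * X)%E]probability_setT mule1; apply => //.
by apply: filterS fM => x fM _; rewrite lee_fin.
Qed.

Lemma bounded_cvg_Rintegral (f_ : nat -> T -> R) (f : T -> R) (M : R) :
  (forall n, measurable_fun setT (f_ n)) -> measurable_fun setT f ->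
  {ae P, forall x, forall n, `|f_ n x| <= M} ->
  {ae P, forall x, f_ n x @[n --> \oo] --> f x} ->
  \int[P]_x f_ n x @[n --> \oo] --> \int[P]_x f x.
Proof.
move=> mf_ mf fM ff.
have intM : P.-integrable setT (EFin \o (fun=> M)) by exact: finite_measure_integrable_cst.
have [| | | | |intf _ h] := @dominated_convergence _ _ _ P setT measurableT
  (fun n x => (f_ n x)%:E) (EFin \o f) (EFin \o (fun=> M)).
- by move=> n; exact/measurable_EFinP.
- exact/measurable_EFinP.
- by apply: filterS ff => x fx _; apply: cvg_EFin => //; exact: nearW.
- exact: intM.
- by apply: filterS fM => x fx n _; rewrite lee_fin.
apply: fine_cvg; rewrite fineK//; exact: integrable_fin_num.
Qed.

End ProbabilityIntegral.

(** * Topology and orthogonal symmetry of the sphere *)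

Section SphereGeometry.
Context {R : realType} {d : nat}.
Local Notation E := 'rV[R]_d.+1.
Local Notation S := (sphere R d).
Implicit Types (x y v w : E).

Lemma dotE v x : dot v x = \sum_i v 0 i * x 0 i.
Proof. by rewrite /dot mxE; apply: eq_bigr => i _; rewrite mxE. Qed.

Lemma dotC v x : dot v x = dot x v.
Proof. by rewrite !dotE; apply: eq_bigr => i _; rewrite mulrC. Qed.

Lemma dotDl u v x : dot (u + v) x = dot u x + dot v x.
Proof. by rewrite /dot mulmxDl mxE. Qed.

Lemma dotZl c v x : dot (c *: v) x = c * dot v x.
Proof. by rewrite /dot -scalemxAl mxE. Qed.

Lemma dotDr u v x : dot x (u + v) = dot x u + dot x v.
Proof. by rewrite dotC dotDl !(dotC x). Qed.

Lemma dotZr c v x : dot x (c *: v) = c * dot x v.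
Proof. by rewrite dotC dotZl !(dotC x). Qed.

Lemma dotBl u v x : dot (u - v) x = dot u x - dot v x.
Proof. by rewrite -scaleN1r dotDl dotZl mulN1r. Qed.

Lemma dotBr u v x : dot x (u - v) = dot x u - dot x v.
Proof. by rewrite dotC dotBl !(dotC x). Qed.

Lemma dot_mulmx v x (Q : 'M[R]_d.+1) : dot v (x *m Q) = dot (v *m Q^T) x.
Proof. by rewrite /dot trmx_mul mulmxA. Qed.

Lemma dot_delta i x : dot (delta_mx 0 i) x = x 0 i.
Proof.
rewrite dotE (bigD1 i)//= !mxE !eqxx mul1r big1 ?addr0// => j ji.
by rewrite mxE (negbTE ji) andbF mul0r.
Qed.

Lemma dot_ge0 x : 0 <= dot x x.
Proof. by rewrite dotE sumr_ge0// => i _; rewrite -expr2 sqr_ge0. Qed.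

Lemma dot_eq0 x : dot x x = 0 -> x = 0.
Proof.
rewrite dotE => /eqP; rewrite psumr_eq0; last first.
  by move=> i _; rewrite -expr2 sqr_ge0.
move=> /allP h; apply/rowP => i; rewrite mxE.
by have := h i (mem_index_enum _); rewrite mulf_eq0 orbb => /eqP.
Qed.

Lemma sphereP x : S x <-> dot x x = 1.
Proof.
rewrite /sphere /enorm /=; split=> [h|->]; last by rewrite sqrtr1.
by rewrite -(sqr_sqrtr (dot_ge0 x)) h expr1n.
Qed.

Lemma dot_sphere_norm v x : S v -> S x -> `|dot v x| <= 1.
Proof.
move=> /sphereP v1 /sphereP x1.
have := dot_ge0 (v - x); have := dot_ge0 (v + x).
rewrite !dotBl !dotBr !dotDl !dotDr (dotC x v) v1 x1 ler_norml; lra.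
Qed.

Lemma sphere_delta i : S (delta_mx 0 i).
Proof. by apply/sphereP; rewrite dot_delta mxE !eqxx. Qed.

(* The witness is the Householder reflection exchanging [v] and [w]. *)
Lemma orthogonal_transitive v w : S v -> S w ->
  exists2 Q : 'M[R]_d.+1, Q *m Q^T = 1%:M & w *m Q^T = v.
Proof.
move=> /sphereP v1 /sphereP w1.
have [<-|vw] := eqVneq v w; first by exists 1%:M; rewrite trmx1 mulmx1.
pose u := w - v.
have uu : dot u u != 0.
  by apply: contra_neq vw => /dot_eq0/eqP; rewrite subr_eq0 => /eqP.
pose Q : 'M[R]_d.+1 := 1%:M - (2 / dot u u) *: (u^T *m u).
have QT : Q^T = Q by rewrite /Q linearB linearZ /= trmx1 trmx_mul trmxK.
have mulQ x : x *m Q = x - (2 / dot u u * dot x u) *: u.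
  rewrite mulmxBr mulmx1 -scalemxAr mulmxA; congr (_ - _).
  by rewrite [x *m u^T]mx11_scalar mul_scalar_mx scalerA.
exists Q; rewrite QT; last first.
  (* As v and w have the same length, |w - v|^2 = 2 w.(w - v), so the reflection moves w by exactly
     u. *)
  rewrite mulQ (_ : 2 / dot u u * dot w u = 1) ?scale1r; last first.
    have : dot u u = 2 * dot w u.
      rewrite /u !dotBl !dotBr (dotC v w) v1 w1; ring.
    by move=> e; rewrite mulrAC -e divff.
  by rewrite /u opprB addrC subrK.
rewrite {2}/Q mulmxBr mulmx1 -scalemxAr mulmxA.
have -> : Q *m u^T = - u^T.
  rewrite -[LHS]trmxK trmx_mul trmxK QT mulQ divfK//.
  by rewrite scaler_nat mulr2n opprD addNKr linearN.
by rewrite mulNmx scalerN opprK /Q subrK.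
Qed.

Lemma continuous_coord i : continuous (fun x : E => x 0 i).
Proof. exact: coord_continuous. Qed.

Lemma continuous_dot v : continuous (dot v : E -> R).
Proof.
rewrite (_ : dot v = (fun x => \sum_i v 0 i * x 0 i)); last first.
  by apply/funext => y; rewrite dotE.
apply: continuous_big => [|i _ x]; first exact: add_continuous.
apply: (@continuousM R E (cst (v 0 i)) (fun y => y 0 i)); first exact: cst_continuous.
exact: continuous_coord.
Qed.

Lemma continuous_enorm : continuous (@enorm R d : E -> R).
Proof.
move=> x; apply: (@continuous_comp _ _ _ (fun x => dot x x)); last exact: sqrt_continuous.
rewrite (_ : (fun x => dot x x) = (fun x => \sum_i x 0 i * x 0 i)); last first.
  by apply/funext => y; rewrite dotE.
apply: continuous_big => [|i _ y]; first exact: add_continuous.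
by apply: (@continuousM R E (fun y => y 0 i) (fun y => y 0 i));
  exact: continuous_coord.
Qed.

Lemma continuous_mulmx (Q : 'M[R]_d.+1) : continuous (fun x : E => x *m Q).
Proof.
have h : (fun x : E => x *m Q) = (fun x => \sum_i x 0 i *: row i Q).
  by apply/funext => y; rewrite mulmx_sum_row.
rewrite h; apply: continuous_big => [|i _ x]; first exact: add_continuous.
by apply: (@cvgZr_tmp _ _ _ (nbhs x) _ (fun y : E => y 0 i)); exact: continuous_coord.
Qed.

Lemma sphere_closed : closed S.
Proof.
rewrite (_ : S = @enorm R d @^-1` [set 1]) //.
apply: closed_comp; last exact: closed_eq.
by move=> x _; exact: continuous_enorm.
Qed.

Lemma sphere_compact : compact S.
Proof.
apply: bounded_closed_compact; last exact: sphere_closed.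
exists 1; split => // M M1 x Sx.
(* In the sup norm only coordinates matter, and a coordinate is the inner product with a unit
   vector. *)
rewrite /Num.norm /= mx_normrE; apply: bigmax_le; first by rewrite (le_trans _ (ltW M1)).
move=> [i j] _ /=; rewrite (le_trans _ (ltW M1))// ord1 -dot_delta.
by apply: dot_sphere_norm => //; exact: sphere_delta.
Qed.

Lemma continuous_sphere_bounded (f : E -> R) : continuous f ->
  exists M, forall x, S x -> `|f x| <= M.
Proof.
move=> cf; have : compact (f @` S).
  by apply: continuous_compact; [exact: continuous_subspaceT|exact: sphere_compact].
move=> /compact_bounded [M [Mr hM]]; exists (M + 1) => x Sx.
by apply: (hM (M + 1)); rewrite ?ltrDl//; exists x.
Qed.

Lemma measurable_open (A : set E) : open A -> measurable (A : set (borelE R d)).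
Proof. exact: sub_sigma_algebra. Qed.

Lemma measurable_sphere : measurable (S : set (borelE R d)).
Proof.
rewrite -(setCK S); apply: measurableC; apply: measurable_open.
exact/closed_openC/sphere_closed.
Qed.

Lemma continuous_measurable_borelE (f : E -> R) : continuous f ->
  measurable_fun setT (f : borelE R d -> R).
Proof.
move=> /continuousP cf; apply: (measurability _ (RGenOpens.measurableE R)).
move=> _ [_ [a [b ->] <-]]; rewrite setTI; apply: measurable_open.
exact/cf/interval_open.
Qed.

Lemma continuous_measurable_borelE2 (f : E -> E) : continuous f ->
  measurable_fun setT (f : borelE R d -> borelE R d).
Proof.
move=> /continuousP cf;
  apply: (@measurability _ _ (borelE R d) (borelE R d) setT f (@open E)) => //.
by move=> _ [A oA <-]; rewrite setTI; apply: measurable_open; exact: cf.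
Qed.

End SphereGeometry.

Section ContinuousHelpers.
Context {R : realType} {V : topologicalType}.

Lemma continuousD_fun (f g : V -> R) : continuous f -> continuous g ->
  continuous (fun x => f x + g x).
Proof. by move=> cf cg x; apply: cvgD; [exact: cf|exact: cg]. Qed.

Lemma continuousM_fun (f g : V -> R) : continuous f -> continuous g ->
  continuous (fun x => f x * g x).
Proof. by move=> cf cg x; apply: cvgM; [exact: cf|exact: cg]. Qed.

Lemma continuousB_fun (f g : V -> R) : continuous f -> continuous g ->
  continuous (fun x => f x - g x).
Proof. by move=> cf cg x; apply: cvgB; [exact: cf|exact: cg]. Qed.

Lemma continuous_norm_fun (f : V -> R) : continuous f ->
  continuous (fun x => `|f x|).
Proof. by move=> cf x; apply: cvg_norm; exact: cf. Qed.

Lemma continuousX_fun (f : V -> R) n : continuous f ->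
  continuous (fun x => f x ^+ n).
Proof.
move=> cf; elim: n => [|n IH]; first exact: cst_continuous.
rewrite (_ : (fun x => _) = (fun x => f x * f x ^+ n)); last first.
  by apply/funext => x; rewrite exprS.
exact: continuousM_fun.
Qed.

Lemma continuous_horner_fun (p : {poly R}) (f : V -> R) : continuous f ->
  continuous (fun x => p.[f x]).
Proof.
by move=> cf x; apply: (@continuous_comp _ _ _ f (horner p)); [exact: cf|exact: continuous_horner].
Qed.

Lemma continuous_sum_fun (n : nat) (F : nat -> V -> R) :
  (forall i, continuous (F i)) -> continuous (fun x => \sum_(i < n) F i x).
Proof.
move=> cF; elim: n => [|n IH].
  rewrite (_ : (fun x => _) = cst 0); first exact: cst_continuous.
  by apply/funext => x; rewrite big_ord0.
rewrite (_ : (fun x => _) = (fun x => \sum_(i < n) F i x + F n x)).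
  exact: continuousD_fun.
by apply/funext => x; rewrite big_ord_recr.
Qed.

End ContinuousHelpers.

(** * Moments of a coordinate under the uniform distribution *)

Section Uniform.
Context {R : realType} {d : nat}.
Local Notation E := 'rV[R]_d.+1.
Local Notation S := (sphere R d).
Variable unif : probability (borelE R d) R.
Hypothesis hunif : is_unif_sphere unif.
Implicit Types (x y v w : E) (f g : E -> R).

Lemma unif_ae_sphere : {ae unif, forall x, S x}.
Proof.
by have [h _] := hunif; apply: probability1_ae => //; exact: measurable_sphere.
Qed.

Lemma unif_integrable f M : measurable_fun setT (f : borelE R d -> R) ->
  (forall x, S x -> `|f x| <= M) -> unif.-integrable setT (EFin \o f).
Proof.
move=> mf fM; apply: (@ae_bounded_integrable _ _ _ _ _ M) => //.
exact: sub_ae unif_ae_sphere.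
Qed.

Lemma unif_integrable_continuous f : continuous f ->
  unif.-integrable setT (EFin \o f).
Proof.
move=> cf; have [M fM] := continuous_sphere_bounded cf.
by apply: unif_integrable fM; exact: continuous_measurable_borelE.
Qed.

Local Notation J f := (\int[unif]_x f x).

Lemma eq_unif f g : continuous f -> continuous g -> (forall x, S x -> f x = g x) ->
  J f = J g.
Proof.
move=> cf cg fg; apply: ae_eq_Rintegral.
- exact: continuous_measurable_borelE.
- exact: continuous_measurable_borelE.
- exact: sub_ae unif_ae_sphere.
Qed.

Lemma unifD f g : continuous f -> continuous g -> J (fun x => f x + g x) = J f + J g.
Proof. by move=> cf cg; rewrite RintegralD//; exact: unif_integrable_continuous. Qed.

Lemma unifZ c f : continuous f -> J (fun x => c * f x) = c * J f.
Proof. by move=> cf; rewrite RintegralZl//; exact: unif_integrable_continuous. Qed.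

Lemma unif_sum (n : nat) (F : nat -> E -> R) : (forall i, continuous (F i)) ->
  J (fun x => \sum_(i < n) F i x) = \sum_(i < n) J (F i).
Proof.
by move=> cF; apply: Rintegral_ord_sum => i; exact: unif_integrable_continuous.
Qed.

Lemma unif_orthogonal (Q : 'M[R]_d.+1) f : Q *m Q^T = 1%:M -> continuous f ->
  J (fun x => f (x *m Q)) = J f.
Proof.
move=> QQ cf; have [_ inv] := hunif.
have mQ : measurable_fun setT ((fun x => x *m Q) : borelE R d -> borelE R d).
  exact: (continuous_measurable_borelE2 (@continuous_mulmx R d Q)).
congr fine.
transitivity (\int[pushforward unif (fun x : borelE R d => (x *m Q : borelE R d))]_x (f x)%:E)%E.
  rewrite integral_pushforward//.
  - by apply/measurable_EFinP; exact: continuous_measurable_borelE.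
  - rewrite preimage_setT; apply: (@unif_integrable_continuous (fun x => f (x *m Q))).
    by move=> x; apply: (@continuous_comp _ _ _ (fun x => x *m Q) f);
      [exact: continuous_mulmx|exact: cf].
by apply: eq_measure_integral => A mA _; exact: inv.
Qed.

Definition unif_poly (p : {poly R}) : R := J (fun x => p.[x 0 0]).

(** Some orthogonal map exchanges v and the first basis vector, so v.x has the same law for every
    unit v. A single functional on polynomials, [unif_poly], thus serves all zonal integrals. *)
Lemma unif_dot (p : {poly R}) v : S v -> J (fun x => p.[dot v x]) = unif_poly p.
Proof.
move=> Sv; have [Q QQ e0Q] := orthogonal_transitive Sv (sphere_delta 0).
rewrite /unif_poly -[RHS](@unif_orthogonal _ _ QQ).
  by apply: eq_Rintegral => x _; rewrite -(dot_delta 0 (x *m Q)) dot_mulmx e0Q.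
exact/continuous_horner_fun/continuous_coord.
Qed.

Lemma unif_poly_is_linear : scalar unif_poly.
Proof.
move=> c p q; rewrite /unif_poly.
under eq_Rintegral do rewrite hornerD hornerZ.
rewrite unifD ?unifZ//.
- exact/continuous_horner_fun/continuous_coord.
- apply: continuousM_fun; first exact: cst_continuous.
  exact/continuous_horner_fun/continuous_coord.
- exact/continuous_horner_fun/continuous_coord.
Qed.

HB.instance Definition _ :=
  GRing.isLinear.Build R {poly R} R *%R unif_poly unif_poly_is_linear.

Lemma unif_poly1 : unif_poly 1 = 1.
Proof.
rewrite /unif_poly; under eq_Rintegral do rewrite hornerC.
exact: Rintegral_cst_probability.
Qed.

(** The antipodal map is orthogonal. *)
Lemma unif_moment_odd k : unif_poly 'X^(k.*2.+1) = 0.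
Proof.
suff : unif_poly 'X^(k.*2.+1) = - unif_poly 'X^(k.*2.+1) by lra.
rewrite {1}/unif_poly -(@unif_orthogonal (- 1%:M)).
- rewrite /unif_poly -[RHS]mulN1r -unifZ.
    apply: eq_Rintegral => x _.
    by rewrite !hornerXn mulmxN mulmx1 mxE exprNn -signr_odd /= odd_double.
  exact/continuous_horner_fun/continuous_coord.
- by rewrite linearN /= trmx1 mulNmx mul1mx opprK.
- exact/continuous_horner_fun/continuous_coord.
Qed.

(* Compare the coefficients of [h ^ 2] in
   [I ((x_0 + h x_i) ^ N) = (1 + h ^ 2) ^ (N / 2) I (x_0 ^ N)]. *)
Lemma unif_moment_mixed k (i : 'I_d.+1) : i != 0 ->
  k.*2.+1%:R * J (fun x => x 0 0 ^+ k.*2 * x 0 i ^+ 2) = unif_poly 'X^(k.*2.+2).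
Proof.
move=> i0; set m := unif_poly _; set N := k.*2.+2.
have cc j : continuous (fun x : E => x 0 j) by exact: continuous_coord.
pose c j := J (fun x => x 0 0 ^+ (N - j) * x 0 i ^+ j).
have key h : \sum_(j < N.+1) ((c j) *+ 'C(N, j)) * h ^+ j = (1 + h ^+ 2) ^+ k.+1 * m.
  pose r := Num.sqrt (1 + h ^+ 2).
  have h1 : 0 < 1 + h ^+ 2 by rewrite ltr_pwDl// sqr_ge0.
  have r0 : r != 0 by rewrite gt_eqF// sqrtr_gt0.
  have rr : r ^+ 2 = 1 + h ^+ 2 by rewrite sqr_sqrtr// ltW.
  pose v : E := r^-1 *: (delta_mx 0 0 + h *: delta_mx 0 i).
  have dv x : dot v x = r^-1 * (x 0 0 + h * x 0 i).
    by rewrite dotZl dotDl dotZl !dot_delta.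
  have Sv : S v.
    apply/sphereP; rewrite dv /v !mxE !eqxx (negbTE i0) eq_sym (negbTE i0) /=.
    rewrite !mulr0 mulr1 addr0 add0r.
    rewrite (_ : r^-1 * _ = r ^- 2 * (1 + h ^+ 2)); last first.
      by rewrite expr2 invfM; ring.
    by rewrite -rr mulVf// expf_neq0.
  rewrite /m -(unif_dot _ Sv).
  have -> : (1 + h ^+ 2) ^+ k.+1 = r ^+ N by rewrite -rr -exprM /N -doubleS mul2n.
  rewrite -unifZ; last first.
    exact/continuous_horner_fun/continuous_dot.
  transitivity (J (fun x => \sum_(j < N.+1)
      (h ^+ j *+ 'C(N, j)) * (x 0 0 ^+ (N - j) * x 0 i ^+ j))).
    rewrite (@unif_sum N.+1 (fun j x => (h ^+ j *+ 'C(N, j)) * (x 0 0 ^+ (N - j) * x 0 i ^+ j))).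
      apply: eq_bigr => j _; rewrite unifZ; last first.
        by apply: continuousM_fun; exact: continuousX_fun.
      by rewrite -/(c j) mulrnAl mulrnAl mulrC.
    move=> j; apply: continuousM_fun; first exact: cst_continuous.
    by apply: continuousM_fun; exact: continuousX_fun.
  apply: eq_Rintegral => x _.
  rewrite hornerXn dv -exprMn mulrA mulfV// mul1r exprDn.
  apply: eq_bigr => j _.
  by rewrite exprMn mulrnAl [in LHS]mulrCA.
have : \poly_(j < N.+1) (c j *+ 'C(N, j)) = (1 + 'X^2) ^+ k.+1 * m%:P.
  apply: eq_poly_horner => h; rewrite horner_poly key.
  by rewrite !(hornerM, horner_exp, hornerD, hornerX, hornerC).
move=> /(congr1 (fun p : {poly R} => p`_2)).
have c0 n : ((1 + 'X^2 : {poly R}) ^+ n)`_0 = 1.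
  elim: n => [|n IH]; first by rewrite expr0 coef1.
  by rewrite exprS mulrDl mul1r coefD coefXnM IH addr0.
have c2 n : ((1 + 'X^2 : {poly R}) ^+ n)`_2 = n%:R.
  elim: n => [|n IH]; first by rewrite expr0 coef1.
  by rewrite exprS mulrDl mul1r coefD coefXnM IH /= subnn c0 natr1.
rewrite coef_poly coefMC c2 /= => e.
(* The binomial coefficient of 2k + 2 over 2 is (k + 1)(2k + 1), while h^2 has coefficient k + 1 on
   the other side. *)
have {}e : (k.+1%:R * (k.*2.+1%:R * c 2)) = k.+1%:R * m.
  rewrite -e mulrA -natrM mulr_natl; congr (_ *+ _).
  by rewrite bin2 /N [_.-1]/= -doubleS -doubleMl doubleK.
have n0 : k.+1%:R != 0 :> R by rewrite pnatr_eq0.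
by move/(mulfI n0): e; rewrite /c /N subn2.
Qed.

(** On the sphere x_0^(2k) is the sum over i of x_0^(2k) x_i^2. The term i = 0 is the next even
    moment, and each of the d others contributes that moment divided by 2k + 1. *)
Lemma unif_moment_rec k :
  k.*2.+1%:R * unif_poly 'X^(k.*2) = (k.*2.+1 + d)%:R * unif_poly 'X^(k.*2.+2).
Proof.
have cc j : continuous (fun x : E => x 0 j) by exact: continuous_coord.
have cm j n : continuous (fun x : E => x 0 0 ^+ k.*2 * x 0 j ^+ n).
  by apply: continuousM_fun; exact: continuousX_fun.
have -> : unif_poly 'X^(k.*2) = \sum_(i < d.+1) J (fun x => x 0 0 ^+ k.*2 * x 0 i ^+ 2).
  (* [unif_sum] takes a family indexed by [nat], hence the passage through [inord]. *)
  transitivity (J (fun x => \sum_(i < d.+1) x 0 0 ^+ k.*2 * x 0 (inord i) ^+ 2)); last first.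
    rewrite (@unif_sum d.+1 (fun i x => x 0 0 ^+ k.*2 * x 0 (inord i) ^+ 2)) //.
    by apply: eq_bigr => i _; rewrite inord_val.
  apply: eq_unif.
  - exact/continuous_horner_fun.
  - exact: (@continuous_sum_fun _ _ d.+1 (fun i x => x 0 0 ^+ k.*2 * x 0 (inord i) ^+ 2)).
  - move=> x /sphereP; rewrite dotE => x1.
    rewrite -mulr_sumr hornerXn -[LHS]mulr1 -x1; congr (_ * _).
    by apply: eq_bigr => i _; rewrite inord_val expr2.
rewrite (bigD1 ord0)//= mulrDr mulr_sumr.
rewrite (eq_bigr (fun=> unif_poly 'X^(k.*2.+2))); last first.
  by move=> i i0; rewrite unif_moment_mixed.
rewrite sumr_const cardC1 card_ord /= -mulr_natl natrD mulrDl; congr (_ * _ + _).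
- by rewrite mulr1.
- by rewrite /unif_poly; apply: eq_Rintegral => x _; rewrite hornerXn -exprD addn2.
- by rewrite mulr_natl.
Qed.

(** By linearity q may be a monomial. For q = X^(n+1) the argument is (n + 1) X^n - (n + 1 + d)
    X^(n+2): both moments vanish for odd n, and for even n the moment recursion applies. *)
Lemma unif_ibp (l : R) : 2 * l + 1 = d%:R -> forall q : {poly R},
  unif_poly ((1 - 'X ^+ 2) * q^`() - (2 * l + 1) *: ('X * q)) = 0.
Proof.
move=> ld q; pose L (q : {poly R}) := (1 - 'X ^+ 2) * q^`() - (2 * l + 1) *: ('X * q).
have LD p1 p2 : L (p1 + p2) = L p1 + L p2 by rewrite /L derivD -!mul_polyC; ring.
have LZ c p1 : L (c *: p1) = c *: L p1 by rewrite /L derivZ -!mul_polyC; ring.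
rewrite -/(L q) -[q]coefK poly_def.
elim: (size q) => [|n IH].
  by rewrite big_ord0 /L linear0 !mulr0 scaler0 subr0 linear0.
rewrite big_ord_recr /= LD LZ linearD linearZ /= IH add0r.
suff -> : unif_poly (L 'X^n) = 0 by rewrite mulr0.
have odd0 k : odd k -> unif_poly 'X^k = 0.
  by move=> ok; rewrite -(odd_double_half k) ok unif_moment_odd.
rewrite /L derivXn ld.
case: n {IH} => [|n].
  rewrite mulr0n mulr0 add0r expr0 mulr1 linearN linearZ /= -['X]expr1.
  by rewrite odd0// mulr0 oppr0.
have -> : (1 - 'X^2) * ('X^n *+ n.+1) - d%:R *: ('X * 'X^(n.+1)) =
    n.+1%:R *: 'X^n - (n.+1 + d)%:R *: 'X^(n.+2) :> {poly R}.
  rewrite -!mul_polyC -mulr_natr natrD polyCD !polyC_natr !exprS; ring.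
have IZ c p : unif_poly (c *: p) = c * unif_poly p by exact: linearZ.
rewrite raddfB /= !IZ.
have [on|en] := boolP (odd n).
  by rewrite (odd0 n on) (odd0 n.+2) ?mulr0 ?subrr//= negbK.
by rewrite -(even_halfK en) unif_moment_rec subrr.
Qed.

(* These polynomials are nonnegative on [-1, 1] and have unit mass; their first
   moment [kernel_tail] around 1 tends to 0, so they concentrate at 1. *)
Definition kernel_poly k : {poly R} :=
  (unif_poly 'X^(k.*2))^-1 *: ('X^(k.*2) * (1 + 'X)).

Lemma unif_moment_even_gt0 k : 0 < unif_poly 'X^(k.*2).
Proof.
elim: k => [|k IH]; first by rewrite expr0 unif_poly1 ltr01.
have := unif_moment_rec k; rewrite doubleS => e.
rewrite -(@pmulr_rgt0 _ (k.*2.+1 + d)%:R) ?ltr0n//.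
by rewrite -e mulr_gt0// ltr0n.
Qed.

Lemma kernel_poly_ge0 k s : `|s| <= 1 -> 0 <= (kernel_poly k).[s].
Proof.
rewrite ler_norml => /andP[s1 _].
rewrite hornerZ hornerM hornerXn hornerD hornerC hornerX.
rewrite mulr_ge0 ?invr_ge0 ?(ltW (unif_moment_even_gt0 k))//.
by rewrite mulr_ge0//; [rewrite -mul2n exprM exprn_ge0 ?sqr_ge0|lra].
Qed.

Lemma unif_kernel_poly k : unif_poly (kernel_poly k) = 1.
Proof.
rewrite linearZ /= mulrDr mulr1 linearD /= -exprSr unif_moment_odd addr0.
by rewrite mulVf// gt_eqF// unif_moment_even_gt0.
Qed.

Definition kernel_tail k : R := d%:R / (k.*2.+1 + d)%:R.

(** Only the moments of order 2k and 2k + 2 remain, and the recursion gives their ratio (2k + 1) /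
    (2k + 1 + d). *)
Lemma unif_kernel_poly_tail k :
  unif_poly (kernel_poly k * (1 - 'X)) = kernel_tail k.
Proof.
rewrite /kernel_tail.
rewrite -scalerAl linearZ /=.
have -> : 'X^(k.*2) * (1 + 'X) * (1 - 'X) = 'X^(k.*2) - 'X^(k.*2.+2) :> {poly R}.
  by rewrite !exprS; ring.
rewrite linearB /=.
have := unif_moment_rec k; have := unif_moment_even_gt0 k.
set m := unif_poly _; set m' := unif_poly _ => m0 e.
have n0 : (k.*2.+1 + d)%:R != 0 :> R by rewrite pnatr_eq0.
have -> : m' = k.*2.+1%:R * m / (k.*2.+1 + d)%:R by rewrite e mulrC mulKf.
have mn0 : m != 0 by rewrite gt_eqF.
have -> : m^-1 * (m - k.*2.+1%:R * m / (k.*2.+1 + d)%:R) =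
    1 - k.*2.+1%:R / (k.*2.+1 + d)%:R.
  by rewrite mulrBr mulVf// mulrA [m^-1 * _]mulrCA mulVf// mulr1.
by rewrite -{1}(divff n0) -mulrBl natrD addrAC subrr add0r.
Qed.

End Uniform.

(** * Approximate identity on the sphere and its Gegenbauer coefficients *)

Section Kernel.
Context {R : realType} {d : nat}.
Local Notation E := 'rV[R]_d.+1.
Local Notation S := (sphere R d).
Variable unif : probability (borelE R d) R.
Hypothesis hunif : is_unif_sphere unif.
Implicit Types (x y v w : E) (f g : E -> R) (p q : {poly R}).
Local Notation J f := (\int[unif]_x f x).
Local Notation I := (unif_poly unif).
Local Notation K := (kernel_poly unif).

Lemma unif_le f g : continuous f -> continuous g ->
  (forall x, S x -> f x <= g x) -> J f <= J g.
Proof.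
move=> cf cg fg; rewrite -subr_ge0.
have cgf : continuous (fun x => g x - f x) by exact: continuousB_fun.
have -> : J g - J f = J (fun x => g x - f x).
  by rewrite RintegralB//; exact: unif_integrable_continuous.
(* The inequality is known on the sphere only. The absolute value is nonnegative everywhere and has
   the same integral. *)
rewrite (@eq_unif _ _ _ hunif _ (fun x => `|g x - f x|))//.
- exact: Rintegral_ge0.
- exact: continuous_norm_fun.
- by move=> x Sx; rewrite ger0_norm// subr_ge0 fg.
Qed.

Lemma unif_norm_le f g : continuous f -> continuous g ->
  (forall x, S x -> `|f x| <= g x) -> `|J f| <= J g.
Proof.
move=> cf cg fg; rewrite ler_norml; apply/andP; split.
  rewrite -mulN1r -unifZ//; apply: unif_le => //.
    by apply: continuousM_fun => //; exact: cst_continuous.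
  by move=> x /fg; rewrite mulN1r ler_norml => /andP[].
by apply: unif_le => // x /fg; rewrite ler_norml => /andP[].
Qed.

Lemma unif_poly_norm_le p q : (forall s, `|s| <= 1 -> `|p.[s]| <= q.[s]) ->
  `|I p| <= I q.
Proof.
move=> pq; apply: unif_norm_le.
- exact/continuous_horner_fun/continuous_coord.
- exact/continuous_horner_fun/continuous_coord.
- move=> x Sx; apply: pq; rewrite -dot_delta.
  by apply: dot_sphere_norm => //; exact: sphere_delta.
Qed.

(** Continuity at x is put in a form linear in 1 - x.v = |x - v|^2 / 2, which the kernels integrate
    to [kernel_tail]. *)
Lemma continuous_close f x : S x -> continuous f -> forall e, 0 < e ->
  exists2 c, 0 <= c & forall v, S v -> `|f v - f x| <= e + c * (1 - dot x v).
Proof.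
move=> Sx cf e e0; have [M fM] := continuous_sphere_bounded cf.
have M0 : 0 <= M by rewrite (le_trans _ (fM _ Sx)).
have /cvgrPdist_lt/(_ _ e0)/nbhs_ballP[r /= r0 hr] := cf x.
(* Outside the ball of radius r, 1 - x.v >= r^2 / 2 while the oscillation is at most 2 M. *)
exists (4 * M / r ^+ 2); first by rewrite divr_ge0 ?sqr_ge0 ?mulr_ge0.
move=> v Sv.
have s1 : 0 <= 1 - dot x v.
  by rewrite subr_ge0 (le_trans (ler_norm _))// dot_sphere_norm.
have [near|far] := ltP (2 * (1 - dot x v)) (r ^+ 2).
  have : `|f x - f v| < e.
    apply: hr; rewrite -ball_normE /=.
    rewrite /Num.norm /= mx_normrE; apply: bigmax_lt => // -[i j] _ /=.
    (* The ball is one of the sup norm, and a coordinate difference is at most the Euclidean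
       distance. *)
    rewrite -ltr_sqr ?nnegrE ?(ltW r0)// -normrX ger0_norm ?sqr_ge0//.
    apply: le_lt_trans near; rewrite ord1 -dot_delta.
    have -> : 2 * (1 - dot x v) = dot (x - v) (x - v).
      move/sphereP : Sx => Sx; move/sphereP : Sv => Sv.
      by rewrite !dotBl !dotBr (dotC v x) Sx Sv; ring.
    rewrite dot_delta dotE (bigD1 j)//= -expr2 lerDl sumr_ge0// => k _.
    by rewrite -expr2 sqr_ge0.
  rewrite distrC => /ltW /le_trans; apply.
  by rewrite lerDl mulr_ge0// divr_ge0 ?sqr_ge0 ?mulr_ge0.
apply: (@le_trans _ _ (2 * M)).
  by rewrite (le_trans (ler_normB _ _))// mulr_natl mulr2n lerD// fM.
apply: (@le_trans _ _ (4 * M / r ^+ 2 * (1 - dot x v))); last by rewrite lerDr ltW.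
have -> : 2 * M = 4 * M / r ^+ 2 * (r ^+ 2 / 2).
  by field; rewrite gt_eqF.
by rewrite ler_wpM2l ?divr_ge0 ?sqr_ge0 ?mulr_ge0//; lra.
Qed.

Local Notation tail := (@kernel_tail R d).

Lemma kernel_tail_cvg0 : tail @ \oo --> 0.
Proof.
apply: (@squeeze_cvgr _ _ _ _ (cst 0) (fun k => d%:R * harmonic k)).
- near=> k; rewrite /kernel_tail divr_ge0//= ler_wpM2l// lef_pV2 ?posrE ?ltr0n//.
  by rewrite ler_nat; lia.
- exact: cvg_cst.
- by rewrite -[X in _ --> X](mulr0 d%:R); apply: cvgMr; exact: cvg_harmonic.
Unshelve. all: by end_near. Qed.

Lemma continuous_kernel k x : continuous (fun v => (K k).[dot x v]).
Proof. exact/continuous_horner_fun/continuous_dot. Qed.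

Lemma kernel_average_le f M k x : S x -> continuous f ->
  (forall v, S v -> `|f v| <= M) -> `|J (fun v => f v * (K k).[dot x v])| <= M.
Proof.
move=> Sx cf fM.
have -> : M = J (fun v => M * (K k).[dot x v]).
  by rewrite unifZ ?unif_dot// ?(unif_kernel_poly hunif) ?mulr1//; exact: continuous_kernel.
apply: unif_norm_le.
- by apply: continuousM_fun => //; exact: continuous_kernel.
- by apply: continuousM_fun; [exact: cst_continuous|exact: continuous_kernel].
- move=> v Sv; have k0 := kernel_poly_ge0 hunif k (dot_sphere_norm Sx Sv).
  by rewrite normrM (ger0_norm k0) ler_wpM2r// fM.
Qed.

(** As v -> K_k(x.v) is a density on the sphere, the error is at most the mean of |f(v) - f(x)|
    under it, hence at most e / 2 + c [tail k] by [continuous_close]. *)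
Lemma kernel_average_cvg f x : S x -> continuous f ->
  J (fun v => f v * (K k).[dot x v]) @[k --> \oo] --> f x.
Proof.
move=> Sx cf; apply/cvgrPdist_le => e e0.
have [c c0 hc] := continuous_close Sx cf (divr_gt0 e0 (@ltr0n R 2)).
have ckk k : continuous (fun v => (K k).[dot x v]) by exact: continuous_kernel.
have bnd k : `|J (fun v => f v * (K k).[dot x v]) - f x| <= e / 2 + c * tail k.
  have -> : f x = J (fun v => f x * (K k).[dot x v]).
    by rewrite unifZ ?unif_dot// (unif_kernel_poly hunif) mulr1.
  have -> : e / 2 + c * tail k =
      J (fun v => (e / 2) * (K k).[dot x v] + c * (K k * (1 - 'X)).[dot x v]).
    rewrite unifD ?unifZ ?unif_dot ?unif_kernel_poly ?unif_kernel_poly_tail ?mulr1//.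
    - exact/continuous_horner_fun/continuous_dot.
    - by apply: continuousM_fun; [exact: cst_continuous|].
    - apply: continuousM_fun; first exact: cst_continuous.
      exact/continuous_horner_fun/continuous_dot.
  have cfk : continuous (fun v => f v * (K k).[dot x v]) by exact: continuousM_fun.
  have cfk' : continuous (fun v => f x * (K k).[dot x v]).
    by apply: continuousM_fun => //; exact: cst_continuous.
  rewrite -RintegralB//; try exact: unif_integrable_continuous.
  apply: unif_norm_le.
  - exact: continuousB_fun.
  - apply: continuousD_fun; apply: continuousM_fun; try exact: cst_continuous; try exact: ckk.
    exact/continuous_horner_fun/continuous_dot.
  - move=> v Sv; have k0 := kernel_poly_ge0 hunif k (dot_sphere_norm Sx Sv).
    rewrite -mulrBl normrM (ger0_norm k0) hornerM hornerD hornerN hornerC hornerX.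
    have := ler_wpM2r k0 (hc _ Sv); lra.
near=> k; rewrite distrC (le_trans (bnd k))//.
have : c * tail k <= e / 2.
  near: k; have : c * tail k @[k --> \oo] --> 0.
    by rewrite -[X in _ --> X](mulr0 c); apply: cvgMr; exact: kernel_tail_cvg0.
  move=> /cvgr_le; apply; exact: divr_gt0.
lra.
Unshelve. all: by end_near. Qed.

Section Gegenbauer.
Variable l : R.
Hypothesis ld : 2 * l + 1 = d%:R.
Hypothesis hl : 1 <= 2 * l.
Local Notation C := (gegenbauer l).

Let l0 : 0 < l. Proof. by move: hl; lra. Qed.

Definition gegenbauer_coef p n := I (p * C n) / I (C n * C n).

Let I1 := unif_poly1 unif.
Let Iibp := unif_ibp hunif ld.

Lemma unif_poly_sqnorm n : I (C n * C n) = l * (C n).[1] / (n%:R + l).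
Proof.
rewrite -(gegenbauer_sqnorm l0 I1 Iibp n) mulrAC mulfV ?mul1r//.
by rewrite gt_eqF// ltr_wpDl.
Qed.

Lemma unif_poly_sqnorm_gt0 n : 0 < I (C n * C n).
Proof.
rewrite unif_poly_sqnorm divr_gt0 ?ltr_wpDl// mulr_gt0//.
by rewrite (lt_le_trans ltr01)// gegenbauer_at1_ge1.
Qed.

(** The length N' is left free above N so that the finite expansion can be compared with arbitrarily
    long partial sums of a series. *)
Lemma gegenbauer_expansion p : exists N, forall N', (N <= N')%N ->
  p = \sum_(n < N') gegenbauer_coef p n *: C n.
Proof.
have [N [b pE]] := gegenbauer_span p l0.
exists N => N' NN'.
pose b' n := if (n < N)%N then b n else 0.
have pE' : p = \sum_(n < N') b' n *: C n.
  rewrite -(big_mkord xpredT (fun n => b' n *: C n)) (big_cat_nat _ NN')//=.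
  rewrite big_mkord [X in _ + X]big_nat [X in _ + X]big1 ?addr0.
    by rewrite {1}pE; apply: eq_bigr => i _; rewrite /b' ltn_ord.
  by move=> n /andP[Nn _]; rewrite /b' ltnNge Nn scale0r.
rewrite {1}pE'; apply: eq_bigr => i _; congr (_ *: _).
rewrite /gegenbauer_coef {1}pE' mulr_suml linear_sum /= (bigD1 i)//= big1 ?addr0.
  by rewrite -scalerAl linearZ /= mulfK// gt_eqF// unif_poly_sqnorm_gt0.
move=> j ji; rewrite -scalerAl linearZ /= gegenbauer_ortho// ?mulr0//.
Qed.

Let sigma := 5 + 6 * l.

(** I (K_k C_n) is a mean of C_n concentrated near 1, hence within r^n [tail k] of C_n(1), where r =
    5 + 6 l. Division by the squared norm l C_n(1) / (n + l) turns the main term C_n(1) into 1 + n /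
    l, and C_n(1) >= 1 bounds the error. *)
Lemma kernel_coef_close k n :
  `|gegenbauer_coef (K k) n - (1 + n%:R / l)| <= (1 + n%:R / l) * sigma ^+ n * tail k.
Proof.
have c1 := gegenbauer_at1_ge1 n hl.
have c0 : 0 < (C n).[1] by rewrite (lt_le_trans ltr01).
have nl : 0 < n%:R + l by rewrite ltr_wpDl.
have A : `|I (K k * C n) - (C n).[1]| <= sigma ^+ n * tail k.
  have -> : (C n).[1] = I (K k * ((C n).[1])%:P).
    by rewrite mulrC mul_polyC linearZ /= (unif_kernel_poly hunif) mulr1.
  rewrite -linearB -mulrBr -(unif_kernel_poly_tail hunif) -linearZ /=.
  apply: unif_poly_norm_le => s s1.
  have k0 := kernel_poly_ge0 hunif k s1.
  have [_] := gegenbauer_bounds n (ltW l0) s1.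
  rewrite hornerM hornerD hornerN hornerC normrM (ger0_norm k0) => h.
  rewrite hornerZ hornerM hornerD hornerN hornerC hornerX mulrCA.
  by rewrite ler_wpM2l.
have -> : gegenbauer_coef (K k) n - (1 + n%:R / l) =
    (1 + n%:R / l) * ((C n).[1])^-1 * (I (K k * C n) - (C n).[1]).
  rewrite /gegenbauer_coef unif_poly_sqnorm; move: (I _) => u; field.
  by rewrite !gt_eqF.
have nl' : 0 <= 1 + n%:R / l by rewrite addr_ge0// divr_ge0// ltW.
rewrite !normrM (ger0_norm nl') -!mulrA ler_wpM2l//.
by rewrite -[leRHS]mul1r ler_pM// gtr0_norm ?invr_gt0// invf_le1//.
Qed.

End Gegenbauer.
End Kernel.

(** * Normalising constants and the equation [beta t = 1] *)

Section GammaFunction.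
Context {R : realType}.

(* [gamma_poly m - (gamma_poly m)' = X^m], so that [- exp(-x) gamma_poly m]
   is a primitive of [x^m exp(-x)]. *)
Fixpoint gamma_poly (m : nat) : {poly R} :=
  if m is k.+1 then 'X^(k.+1) + k.+1%:R *: gamma_poly k else 1.

Lemma deriv_gamma_poly m : gamma_poly m - (gamma_poly m)^`() = 'X^m.
Proof.
elim: m => [|m IH] /=; first by rewrite deriv_poly1 subr0 expr0.
rewrite derivD derivXn derivZ opprD addrACA -scalerBr IH /=.
by rewrite -scaler_nat addrNK.
Qed.

Lemma gamma_poly_at0 m : (gamma_poly m).[0] = m`!%:R.
Proof.
elim: m => [|m IH] /=; first by rewrite hornerC.
by rewrite hornerD hornerZ hornerXn IH expr0n add0r factS natrM.
Qed.

(** One term of the exponential series, exp(x) >= x^(m+1) / (m+1)!, gives the bound (m+1)! / x. *)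
Lemma expRN_Xn_cvg0 m : expR (- x) * x ^+ m @[x --> +oo] --> (0 : R).
Proof.
apply: (@squeeze_cvgr _ _ _ _ (cst 0) (fun x => m.+1`!%:R * x^-1)).
- near=> x.
  have x0 : 0 < x by near: x; exact: nbhs_pinfty_gt.
  rewrite mulr_ge0 ?expR_ge0 ?exprn_ge0 ?ltW//=.
  rewrite ltr_pdivlMr// -mulrA -exprSr expRN mulrC ltr_pdivrMr ?expR_gt0//.
  have h := expR_ge1Dxn m (ltW x0).
  have f0 : (0 : R) < m.+1`!%:R by rewrite ltr0n fact_gt0.
  by rewrite mulrC -ltr_pdivrMr// (lt_le_trans _ h)// ltrDr.
- exact: cvg_cst.
- rewrite -[X in _ --> X](mulr0 m.+1`!%:R); apply: cvgMr.
  apply: (gtr0_cvgV0 _).2; first exact: nbhs_pinfty_gt.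
  exact: cvg_id.
Unshelve. all: by end_near. Qed.

Lemma expRN_gamma_poly_cvg0 m : expR (- x) * (gamma_poly m).[x] @[x --> +oo] --> (0 : R).
Proof.
elim: m => [|m IH] /=.
  rewrite (_ : (fun x => _) = (fun x : R => expR (- x) * x ^+ 0)).
    exact: expRN_Xn_cvg0.
  by apply/funext => x; rewrite hornerC expr0.
rewrite (_ : (fun x => _) = (fun x : R => expR (- x) * x ^+ m.+1 +
   m.+1%:R * (expR (- x) * (gamma_poly m).[x]))); last first.
  by apply/funext => x; rewrite hornerD hornerXn hornerZ mulrDr mulrCA.
rewrite -[X in _ --> X](addr0 0); apply: cvgD; first exact: expRN_Xn_cvg0.
by rewrite -[X in _ --> X](mulr0 m.+1%:R); apply: cvgMr.
Qed.

Lemma Gamma_fact m : Gamma (m.+1%:R : R) = m`!%:R.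
Proof.
pose f (x : R) := x ^+ m * expR (- x).
pose F (x : R) := - (expR (- x) * (gamma_poly m).[x]).
have cf : continuous f.
  move=> x; apply: cvgM; first exact: exprn_continuous.
  apply: (@continuous_comp _ _ _ -%R expR); first exact: opp_continuous.
  exact: continuous_expR.
have dF (x : R) : is_derive x 1 F (f x).
  have dP : is_derive x 1 (horner (gamma_poly m)) (gamma_poly m)^`().[x].
    rewrite derivE derive1E; exact/derivableP/derivable_horner.
  rewrite /F /f; apply: is_derive_eq.
  rewrite -hornerXn -deriv_gamma_poly hornerD hornerN.
  rewrite -![_ *: _]/(_ * _); ring.
transitivity (\int[lebesgue_measure]_(x in `[0, +oo[) f x).
  transitivity (\int[lebesgue_measure]_(x in `]0, +oo[) f x).
    apply: eq_Rintegral => x; rewrite inE /= in_itv /= andbT => x0.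
    by rewrite -natr1 addrK powR_mulrn// ltW.
  rewrite /Rintegral integral_itv_obnd_cbnd//.
  apply: measurable_funTS; apply/measurable_EFinP. exact: continuous_measurable_fun.
rewrite (@Rintegral_ge0_continuous_FTC2y _ f F 0 0).
- by rewrite /F oppr0 expR0 mul1r sub0r opprK gamma_poly_at0.
- by move=> x x0; rewrite /f mulr_ge0 ?expR_ge0 ?exprn_ge0.
- exact: continuous_subspaceT.
- by rewrite -[X in _ --> X]oppr0; apply: cvgN; exact: expRN_gamma_poly_cvg0.
- by move=> x _; have [] := dF x.
- apply: cvg_at_right_filter; apply: differentiable_continuous.
  by apply/derivable1_diffP; have [] := dF 0.
- by move=> x _; rewrite derive1E; have [] := dF x.
Qed.

(** As 2 l is a positive integer, Gamma takes factorial values, and (m + n)! / (m! n!) satisfies the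
    recursion [gegenbauer_at1]. *)
Lemma poch_gegenbauer_at1 (m n : nat) (l : R) : 2 * l = m.+1%:R ->
  poch (2 * l) n / n`!%:R = (gegenbauer l n).[1].
Proof.
move=> lm; have Gm k : Gamma (2 * l + k%:R) = (m + k)`!%:R.
  by rewrite lm -natrD addSn Gamma_fact.
have m0 k : k`!%:R != 0 :> R by rewrite pnatr_eq0 -lt0n fact_gt0.
have G0 : Gamma (2 * l) = m`!%:R by rewrite lm Gamma_fact.
rewrite /poch Gm G0.
elim: n => [|n IH]; first by rewrite hornerC addn0 divff// fact0 divr1.
have n0 : n.+1%:R != 0 :> R by rewrite pnatr_eq0.
apply: (mulfI n0); rewrite gegenbauer_at1 -IH lm addnS !factS !natrM -natrD.
rewrite (_ : (n + m.+1)%N = (m + n).+1); last by lia.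
field.
by rewrite !m0 addrC natr1 n0.
Qed.

End GammaFunction.

Section Series.
Context {R : realType}.
Implicit Types u v : R^nat.

Lemma le_lim_series u N : (forall n, 0 <= u n) -> cvgn (series u) ->
  \sum_(n < N) u n <= limn (series u).
Proof.
move=> u0 cu; rewrite -(big_mkord xpredT).
apply: (@nondecreasing_cvgn_le _ (series u)) => //.
by apply: nondecreasing_series => n _ _; exact: u0.
Qed.

Lemma term_le_lim_series u n : (forall n, 0 <= u n) -> cvgn (series u) ->
  u n <= limn (series u).
Proof.
move=> u0 cu; apply: le_trans (le_lim_series n.+1 u0 cu).
by rewrite big_ord_recr /= lerDr sumr_ge0.
Qed.

(** Results on [series] start at index 0, the sum in [beta] at index 1. *)
Lemma sum1_series u :
  (fun N => \sum_(1 <= n < N) u n) = series (fun n => if n is 0 then 0 else u n).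
Proof.
apply/funext => -[|N]; first by rewrite big_geq// /series/= big_geq.
rewrite /series /= [RHS]big_ltn// add0r.
by rewrite big_nat [RHS]big_nat; apply: eq_bigr => -[].
Qed.

End Series.

(** * Heat coefficients and the function [beta] *)

Section Heat.
Context {R : realType}.
Implicit Types (l t rho : R) (n : nat) (u : R^nat).

Definition heat l t n : R := expR (- (n%:R * (n%:R + 2 * l) * t / 2)).

Lemma heat_ge0 l t n : 0 <= heat l t n.
Proof. exact: expR_ge0. Qed.

(** With a = ln (2 rho), completing the square gives n a - n^2 t / 2 <= a^2 / (2 t), uniformly in
    n. *)
Lemma heat_geometric l t rho : 0 <= l -> 0 < t -> 0 < rho ->
  exists c, forall n, rho ^+ n * heat l t n <= c * 2^-1 ^+ n.
Proof.
move=> l0 t0 rho0; pose a := ln rho + ln 2; exists (expR (a ^+ 2 / (2 * t))) => n.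
rewrite exprVn ler_pdivlMr ?exprn_gt0// mulrAC -exprMn.
have -> : rho * 2 = expR a by rewrite /a expRD !lnK// posrE.
rewrite -expRM_natl /heat -expRD ler_expR.
have n0 : (0 : R) <= n%:R by [].
apply: (@le_trans _ _ (n%:R * a - n%:R ^+ 2 * t / 2)).
  rewrite lerD2l lerN2 ler_pM2r ?invr_gt0// ler_pM2r//.
  by rewrite expr2 ler_wpM2l// lerDl mulr_ge0.
rewrite ler_pdivlMr ?mulr_gt0//.
have : 0 <= (a - n%:R * t) ^+ 2 by rewrite sqr_ge0.
nra.
Qed.

Lemma cvg_normed_heat l t rho u : 0 <= l -> 0 < t -> 0 < rho ->
  (forall n, `|u n| <= rho ^+ n * heat l t n) -> cvgn [normed series u].
Proof.
move=> l0 t0 rho0 hu; have [c hc] := heat_geometric l0 t0 rho0.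
apply: (@series_le_cvg _ _ (geometric c 2^-1)) => //.
- by move=> n; exact: normr_ge0.
- move=> n; apply: (le_trans _ (hc n)).
  by rewrite mulr_ge0 ?heat_ge0// exprn_ge0// ltW.
- by move=> n; apply: (le_trans (hu n)); exact: hc.
- apply: is_cvg_geometric_series; rewrite ger0_norm//; lra.
Qed.

Lemma cvg_series_heat l t rho u : 0 <= l -> 0 < t -> 0 < rho ->
  (forall n, `|u n| <= rho ^+ n * heat l t n) -> cvgn (series u).
Proof. by move=> l0 t0 r0 hu; apply: normed_cvg; apply: cvg_normed_heat hu. Qed.

(** Bernoulli's inequality: the linear weight is absorbed into the geometric rate. *)
Lemma weight_bounds l n : 0 < l ->
  0 <= 1 + n%:R / l <= (1 + l^-1) ^+ n.
Proof.
move=> l0; have l1 : 0 <= l^-1 by rewrite invr_ge0 ltW.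
rewrite addr_ge0 ?mulr_ge0//=.
elim: n => [|n IH]; first by rewrite mul0r addr0.
rewrite exprS; apply: le_trans (ler_wpM2l _ IH); last by rewrite addr_ge0.
rewrite -natr1; have n0 : 0 <= n%:R * l^-1 ^+ 2 by rewrite mulr_ge0// sqr_ge0.
move: n0; rewrite expr2; lra.
Qed.

(** For s <= t, factor out exp(- c s) <= exp(- c a) and use 1 - exp(- x) <= x with x = c (t - s). *)
Lemma heat_diff l a s t n : 0 <= l -> a <= s -> a <= t ->
  `|heat l s n - heat l t n| <=
  `|s - t| * (n%:R * (n%:R + 2 * l) / 2 * heat l a n).
Proof.
move=> l0; wlog st : s t / s <= t.
  move=> H sa ta; have [/H|/ltW/H] := leP s t; first exact.
  by rewrite distrC (distrC s); exact.
move=> sa ta; set c := n%:R * (n%:R + 2 * l) / 2.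
have c0 : 0 <= c by rewrite divr_ge0// mulr_ge0// addr_ge0// mulr_ge0.
have hE r : heat l r n = expR (- (c * r)) by rewrite /heat /c; congr expR; ring.
rewrite !hE -[`|s - t|]normrN opprB [`|t - s|]ger0_norm ?subr_ge0//.
have -> : expR (- (c * t)) = expR (- (c * s)) * expR (- (c * (t - s))).
  by rewrite -expRD; congr expR; ring.
rewrite -{1}[expR (- (c * s))]mulr1 -mulrBr normrM ger0_norm ?expR_ge0//.
have x0 : 0 <= c * (t - s) by rewrite mulr_ge0// subr_ge0.
have h1 := expR_ge1Dx (- (c * (t - s))).
rewrite ger0_norm; last first.
  by rewrite subr_ge0 -[leRHS]expR0 ler_expR oppr_le0.
apply: (@le_trans _ _ (expR (- (c * a)) * (c * (t - s)))); last by lra.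
apply: ler_pM; rewrite ?expR_ge0//.
- by rewrite subr_ge0 -[leRHS]expR0 ler_expR oppr_le0.
- by rewrite ler_expR lerN2 ler_wpM2l.
- lra.
Qed.

Section Beta.
Variables (l : R) (m : nat).
Hypothesis lm : 2 * l = m.+1%:R.

Let l2 : 1 <= 2 * l. Proof. by rewrite lm ler1n. Qed.
Let l0 : 0 < l. Proof. by move: l2; lra. Qed.

Lemma beta_termE t n :
  beta_term l t n = (1 + n%:R / l) * (gegenbauer l n).[1] * heat l t n.
Proof. by rewrite /beta_term (poch_gegenbauer_at1 n lm). Qed.

Let rho := (1 + l^-1) * (5 + 6 * l).

Let rho_ge1 : 1 <= rho.
Proof.
have : 0 <= l^-1 by rewrite invr_ge0 ltW.
rewrite /rho; move: l0; nra.
Qed.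

Lemma beta_weight_bounds n :
  0 <= (1 + n%:R / l) * (gegenbauer l n).[1] <= rho ^+ n.
Proof.
have /andP[w0 w1] := weight_bounds n l0.
have c0 : 0 <= (gegenbauer l n).[1] by rewrite (le_trans ler01)// gegenbauer_at1_ge1.
have s1 : `|1 : R| <= 1 by rewrite normr1.
have [c1 _] := gegenbauer_bounds n (ltW l0) s1.
rewrite mulr_ge0//= exprMn ler_pM//.
by rewrite (le_trans (ler_norm _)).
Qed.

Lemma beta_term_ge0 t n : 0 <= beta_term l t n.
Proof.
rewrite beta_termE mulr_ge0 ?heat_ge0//.
by have /andP[] := beta_weight_bounds n.
Qed.

Let bseq t n := if n is 0 then 0 else beta_term l t n.

Let bseq_ge0 t n : 0 <= bseq t n.
Proof. by case: n => // n; exact: beta_term_ge0. Qed.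

Lemma beta_term_le t n : beta_term l t n <= rho ^+ n * heat l t n.
Proof.
rewrite beta_termE ler_wpM2r ?heat_ge0//.
by have /andP[] := beta_weight_bounds n.
Qed.

Let bseq_le t n : `|bseq t n| <= rho ^+ n * heat l t n.
Proof.
rewrite ger0_norm//; case: n => [|n]; last exact: beta_term_le.
by rewrite mulr_ge0 ?heat_ge0// exprn_ge0// (le_trans ler01).
Qed.

Let rho0 : 0 < rho. Proof. by rewrite (lt_le_trans ltr01). Qed.

Let cvg_bseq t : 0 < t -> cvgn (series (bseq t)).
Proof. by move=> t0; apply: (cvg_series_heat (ltW l0) t0 rho0); exact: bseq_le. Qed.

Let betaE t : beta l t = limn (series (bseq t)).
Proof. by rewrite /beta sum1_series. Qed.

Lemma cvg_beta t : 0 < t ->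
  (fun N => \sum_(1 <= n < N) beta_term l t n) @ \oo --> beta l t.
Proof. by move=> t0; rewrite betaE sum1_series; exact: cvg_bseq. Qed.

(** No term increases with time, and the sum of the nonnegative differences is at least the
    difference of the terms n = 1, which is positive. *)
Lemma beta_decreasing s t : 0 < s -> s < t -> beta l t < beta l s.
Proof.
move=> s0 st; have t0 := lt_trans s0 st.
rewrite !betaE -subr_gt0 -lim_seriesB; [|exact: cvg_bseq..].
have heat_lt n : heat l t n.+1 < heat l s n.+1.
  rewrite ltr_expR ltrN2 ltr_pM2r ?invr_gt0// ltr_pM2l//.
  by rewrite mulr_gt0// ltr_wpDr// mulr_ge0// ltW.
have diff_ge0 n : 0 <= (bseq s - bseq t) n.
  case: n => [|n]; first by rewrite -[(_ - _) 0%N]/(0 - 0 : R) subrr.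
  rewrite -[_ n.+1]/(beta_term l s n.+1 - beta_term l t n.+1) subr_ge0 !beta_termE.
  rewrite ler_wpM2l ?(ltW (heat_lt _))//.
  by have /andP[] := beta_weight_bounds n.+1.
apply: lt_le_trans (term_le_lim_series 1 diff_ge0 _); last first.
  by apply: is_cvg_seriesB; exact: cvg_bseq.
rewrite -[_ 1%N]/(beta_term l s 1 - beta_term l t 1) subr_gt0 !beta_termE.
rewrite ltr_pM2l// mulr_gt0//.
  by rewrite addr_gt0// divr_gt0.
by rewrite (lt_le_trans ltr01)// gegenbauer_at1_ge1.
Qed.

Lemma beta_lipschitz a : 0 < a ->
  exists L, forall s t, a <= s -> a <= t -> `|beta l s - beta l t| <= L * `|s - t|.
Proof.
move=> a0.
pose v n := n%:R * (n%:R + 2 * l) / 2 * (rho ^+ n * heat l a n).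
have v0 n : 0 <= v n.
  rewrite /v; apply: mulr_ge0; last by rewrite mulr_ge0 ?heat_ge0// exprn_ge0// ltW.
  by rewrite divr_ge0// mulr_ge0// addr_ge0// mulr_ge0// ltW.
have cv : cvgn (series v).
  (* The rate 4 (1 + l) absorbs n (n + 2 l) / 2: n <= 2^n and (n + 2 l) / 2 <= (2 (1 + l))^n for n
     >= 1. *)
  apply: (@cvg_series_heat l a (4 * (1 + l) * rho)) => //; first exact: ltW.
    by rewrite mulr_gt0// mulr_gt0// addr_gt0.
  move=> n; rewrite ger0_norm// /v [X in _ <= X * _]exprMn -[leRHS]mulrA ler_wpM2r//.
    by rewrite mulr_ge0 ?heat_ge0// exprn_ge0// ltW.
  case: n => [|n]; first by rewrite !mul0r expr0.
  rewrite (_ : 4 * (1 + l) = 2 * (2 * (1 + l))); last by ring.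
  rewrite exprMn -mulrA ler_pM//.
  - by rewrite divr_ge0// addr_ge0// mulr_ge0// ltW.
  - by rewrite -natrX ler_nat ltnW// ltn_expl.
  - rewrite exprMn; apply: (@le_trans _ _ (2 ^+ n.+1 * (1 + l))).
      have : n.+1%:R <= 2 ^+ n.+1 :> R by rewrite -natrX ler_nat ltnW// ltn_expl.
      have : 1 <= 2 ^+ n.+1 :> R by rewrite exprn_ege1// ler1n.
      move: l0; nra.
    rewrite ler_wpM2l ?exprn_ge0// exprS -[leLHS]mulr1 ler_wpM2l//.
      by rewrite addr_ge0// ltW.
    by rewrite exprn_ege1// lerDl ltW.
exists (limn (series v)) => s t sa ta.
have s0 := lt_le_trans a0 sa; have t0 := lt_le_trans a0 ta.
have dle n : `|(bseq s - bseq t) n| <= (`|s - t| *: v) n.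
  case: n => [|n].
    rewrite -[_ 0%N]/(0 - 0) subrr normr0.
    by rewrite -[X in _ <= X]/(`|s - t| * v 0%N) mulr_ge0.
  rewrite -[_ n.+1]/(beta_term l s n.+1 - beta_term l t n.+1) !beta_termE -mulrBr.
  have /andP[w0 w1] := beta_weight_bounds n.+1.
  rewrite normrM (ger0_norm w0) -[X in _ <= X]/(`|s - t| * v n.+1).
  have := @heat_diff l a s t n.+1 (ltW l0) sa ta.
  set h := heat l a n.+1; set c := _ / 2 => hd.
  apply: (@le_trans _ _ (rho ^+ n.+1 * (`|s - t| * (c * h)))).
    by rewrite ler_pM.
  by rewrite /v -/h -/c; lra.
have cstv : cvgn (series (`|s - t| *: v)) by apply: is_cvg_seriesZ.
have cnd : cvgn [normed series (bseq s - bseq t)].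
  apply: series_le_cvg cstv; [|move=> n|exact: dle].
    by move=> n; exact: normr_ge0.
  by rewrite -[X in _ <= X]/(`|s - t| * v n) mulr_ge0.
rewrite !betaE -lim_seriesB; [|exact: cvg_bseq..].
apply: (le_trans (lim_series_norm cnd)).
rewrite mulrC -[leRHS]/(`|s - t| *: limn (series v)) -lim_seriesZ//.
exact: lim_series_le.
Qed.

Lemma beta_continuous a b : 0 < a -> {within `[a, b], continuous (beta l)}.
Proof.
(* A Lipschitz bound on [a / 2, oo) covers a full neighbourhood of the endpoint a. *)
move=> a0; have a20 : 0 < a / 2 by rewrite divr_gt0.
have [L hL] := beta_lipschitz a20.
apply: continuous_in_subspaceT => x; rewrite inE /= in_itv /= => /andP[ax _].
apply/cvgrPdist_le => e e0; near=> y.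
have ya : a / 2 <= y.
  by near: y; apply: (@cvgr_ge _ _ _ _ id x); [exact: cvg_id|lra].
apply: (le_trans (hL _ _ _ ya)); first by lra.
have L1 : 0 < `|L| + 1 by rewrite ltr_wpDl.
apply: (@le_trans _ _ ((`|L| + 1) * `|x - y|)).
  by rewrite ler_wpM2r// (le_trans (ler_norm L))// lerDl.
rewrite -ler_pdivlMl// mulrC.
near: y; apply/nbhs_ballP; exists (e / (`|L| + 1)); first by rewrite /= divr_gt0.
by move=> y/= /ltW.
Unshelve. all: by end_near. Qed.

Lemma beta_le1 : exists2 t, 0 < t & beta l t <= 1.
Proof.
(* At t = 8 rho the term n >= 1 is at most (rho exp(- 4 rho))^n <= 4^(- n) <= 2^(- n - 1), and the
   powers 2^(- n - 1), n >= 0, sum to 1. *)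
exists (2 * (4 * rho)); first by rewrite mulr_gt0// mulr_gt0.
have t0 : 0 < 2 * (4 * rho) by rewrite mulr_gt0// mulr_gt0.
rewrite betaE.
have geo : series (geometric (2^-1 : R) 2^-1) @ \oo --> (1 : R).
  rewrite [X in _ --> X](_ : _ = 2^-1 * (1 - 2^-1)^-1); last by field.
  by apply: cvg_geometric_series; rewrite ger0_norm//; lra.
rewrite -[leRHS](cvg_lim _ geo)//; apply: lim_series_le.
- exact: (cvg_bseq t0).
- exact: cvgP geo.
move=> [|n]; first by rewrite /= expr0 mulr1.
apply: (@le_trans _ _ ((4^-1) ^+ n.+1)); last first.
  rewrite /= -exprS (_ : 4^-1 = 2^-1 ^+ 2); last by field.
  rewrite -exprM; apply: ler_wiXn2l => //; first lra.
  by lia.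
apply: le_trans (beta_term_le _ _) _.
apply: (@le_trans _ _ ((rho * expR (- (4 * rho))) ^+ n.+1)).
  rewrite [leRHS]exprMn ler_wpM2l ?exprn_ge0 ?(ltW rho0)//.
  rewrite -expRM_natl /heat ler_expR mulrN lerN2.
  rewrite (_ : _ * _ / 2 = n.+1%:R * (n.+1%:R + 2 * l) * (4 * rho)); last by field.
  have step : n.+1%:R <= n.+1%:R * (n.+1%:R + 2 * l) :> R.
    have n0 : 0 <= n%:R :> R by [].
    by rewrite -natr1; move: l0; nra.
  by rewrite ler_wpM2r// mulr_ge0// ltW.
rewrite lerXn2r ?nnegrE ?(mulr_ge0 (ltW rho0)) ?expR_ge0//.
rewrite expRN ler_pdivrMr ?expR_gt0//.
have := expR_ge1Dx (4 * rho); lra.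
Qed.

Lemma beta_ge1 : exists2 t, 0 < t & 1 <= beta l t.
Proof.
(* This makes the exponent of the term n = 1 equal to - 1/2. That term is (2 l + 2) exp(- 1/2) >= l
   + 1, since exp(- 1/2) >= 1/2. *)
exists (1 + 2 * l)^-1; first by rewrite invr_gt0 addr_gt0// mulr_gt0.
have t0 : 0 < (1 + 2 * l)^-1 by rewrite invr_gt0 addr_gt0// mulr_gt0.
rewrite betaE.
apply: le_trans (term_le_lim_series 1 (@bseq_ge0 _) (cvg_bseq t0)).
rewrite -[bseq _ 1]/(beta_term l _ 1) beta_termE gegenbauer1 hornerZ hornerX /heat.
have h := expR_ge1Dx (- (1 * (1 + 2 * l) * (1 + 2 * l)^-1 / 2) : R).
have e : (1 * (1 + 2 * l) * (1 + 2 * l)^-1 / 2) = 2^-1 :> R.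
  by rewrite mul1r mulfV ?div1r// gt_eqF// addr_gt0// mulr_gt0.
rewrite e in h *.
have -> : (1 + 1 / l) * (2 * l * 1) = 2 * l + 2 by field; rewrite gt_eqF.
move: h l2; nra.
Qed.

Lemma beta_eq1 : exists! t0, 0 < t0 /\ beta l t0 = 1.
Proof.
have [a a0 ha] := beta_ge1; have [b b0 hb] := beta_le1.
have ab : a <= b.
  by rewrite leNgt; apply/negP => /(beta_decreasing b0); lra.
have [] := @IVT _ (beta l) a b 1 ab (@beta_continuous a b a0).
  by rewrite ge_min hb orbT /= le_max ha.
move=> t; rewrite in_itv /= => /andP[ta _] bt; exists t; split.
  by split => //; exact: lt_le_trans ta.
move=> s [s0 bs]; apply/eqP; rewrite eq_le; apply/andP; split; rewrite leNgt; apply/negP.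
  by move=> /(beta_decreasing s0); rewrite bt bs ltxx.
by move=> /(beta_decreasing (lt_le_trans a0 ta)); rewrite bt bs ltxx.
Qed.

End Beta.
End Heat.

(** * Laplacian of zonal functions and the martingale problem *)

Section SmoothExpressions.
Context {R : realType} {d : nat}.
Local Notation E := 'rV[R]_d.+1.
Local Notation S := (sphere R d).
Implicit Types (x y u v : E).

Lemma derive_chain (f : E -> R) (g : R -> R) y u : differentiable f y ->
  derivable g (f y) 1 ->
  differentiable (g \o f) y /\ 'D_u (g \o f) y = g^`()%classic (f y) * 'D_u f y.
Proof.
move=> df dg; have dg' : differentiable g (f y) by exact/derivable1_diffP.
have dgf : differentiable (g \o f) y by exact: differentiable_comp.
split=> //; rewrite !deriveE// diff_comp//= deriv1E//.
by rewrite -[LHS]/(_ * _) mulrC.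
Qed.

Lemma dot_is_linear v : linear (dot v : E -> R^o).
Proof. by move=> c x y; rewrite dotDr dotZr. Qed.

Lemma differentiable_dot v y : differentiable (dot v : E -> R) y /\
  forall u, 'D_u (dot v : E -> R) y = dot v u.
Proof.
pose f : {linear E -> R^o} := HB.pack (dot v : E -> R^o)
  (GRing.isLinear.Build _ _ _ _ _ (dot_is_linear v)).
have cf : continuous f by exact: continuous_dot.
have df : differentiable f y by exact: linear_differentiable.
by split=> // u; rewrite (deriveE _ df) (diff_lin _ cf).
Qed.

Lemma differentiable_sqnorm y : differentiable (fun y : E => dot y y) y /\
  forall u, 'D_u (fun y : E => dot y y) y = 2 * dot u y.
Proof.
have -> : (fun y : E => dot y y) = \sum_i (fun y : E => y 0 i * y 0 i).
  by apply/funext => z; rewrite fct_sumE dotE.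
have dc i : differentiable (fun y : E => y 0 i) y by exact: differentiable_coord.
have dM i : differentiable (fun y : E => y 0 i * y 0 i) y.
  exact: (differentiableM (dc i) (dc i)).
split=> [|u]; first exact: differentiable_sum.
rewrite derive_sum; last by move=> i; exact: diff_derivable.
rewrite dotE mulr_sumr; apply: eq_bigr => i _.
have dcu : 'D_u (fun y : E => y 0 i) y = u 0 i.
  have -> : (fun y : E => y 0 i) = dot (delta_mx 0 i) by apply/funext => z; rewrite dot_delta.
  by rewrite (differentiable_dot _ _).2 dot_delta.
rewrite (@deriveM _ _ (fun y : E => y 0 i) (fun y : E => y 0 i)) ?dcu; try exact: diff_derivable.
by rewrite -[_ *: _]/(_ * _); ring.
Qed.

Definition inv_norm (y : E) : R := (enorm y)^-1.

Lemma differentiable_inv_norm y : y != 0 -> differentiable inv_norm y /\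
  forall u, 'D_u inv_norm y = - (inv_norm y) ^+ 3 * dot u y.
Proof.
move=> y0.
have yy : 0 < dot y y.
  by rewrite lt_neqAle dot_ge0 andbT eq_sym; apply: contra_neq y0; exact: dot_eq0.
pose g (t : R) := (Num.sqrt t)^-1.
have sn0 : Num.sqrt (dot y y) != 0 by rewrite gt_eqF// sqrtr_gt0.
have ds := is_derive1_sqrt yy.
have dg : is_derive (dot y y) 1 g (- (Num.sqrt (dot y y)) ^- 2 *: (2 * Num.sqrt (dot y y))^-1).
  exact: is_deriveV.
have [dq Dq] := differentiable_sqnorm y.
have dg1 : derivable g (dot y y) 1 by have [] := dg.
split=> [|u]; first by have [] := derive_chain 0 dq dg1.
have [_ ->] := derive_chain u dq dg1.
rewrite derive1E Dq; have [_ ->] := dg.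
rewrite /inv_norm /enorm -[_ *: _]/(_ * _); field.
by rewrite sn0.
Qed.

(* A class of functions stable under directional derivatives away from the
   origin, with [SInv] standing for [y |-> 1 / |y|]. *)
Inductive sexpr :=
  | SCst of R | SLin of E | SInv
  | SAdd of sexpr & sexpr | SMul of sexpr & sexpr | SPol of {poly R} & sexpr.

Fixpoint seval (e : sexpr) (y : E) : R :=
  match e with
  | SCst c => c
  | SLin v => dot v y
  | SInv => inv_norm y
  | SAdd a b => seval a y + seval b y
  | SMul a b => seval a y * seval b y
  | SPol p a => p.[seval a y]
  end.

Fixpoint sderiv (u : E) (e : sexpr) : sexpr :=
  match e with
  | SCst _ => SCst 0
  | SLin v => SCst (dot v u)
  | SInv => SMul (SMul (SCst (-1)) (SMul SInv (SMul SInv SInv))) (SLin u)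
  | SAdd a b => SAdd (sderiv u a) (sderiv u b)
  | SMul a b => SAdd (SMul a (sderiv u b)) (SMul b (sderiv u a))
  | SPol p a => SMul (SPol p^`() a) (sderiv u a)
  end.

Lemma seval_derive e y : y != 0 -> differentiable (seval e) y /\
  forall u, 'D_u (seval e) y = seval (sderiv u e) y.
Proof.
move=> y0; elim: e => [c|v||a [da Da] b [db Db]|a [da Da] b [db Db]|p a [da Da]] /=.
- split; first exact: differentiable_cst.
  by move=> u; rewrite (derive_cst (c : R)).
- exact: differentiable_dot.
- have [h1 h2] := differentiable_inv_norm y0; split=> // u.
  by rewrite h2; ring.
- split; first exact: (differentiableD da db).
  move=> u; rewrite (@deriveD _ _ _ (seval a) (seval b)) ?Da ?Db//; exact: diff_derivable.
- split; first exact: (differentiableM da db).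
  move=> u; rewrite (@deriveM _ _ (seval a) (seval b)) ?Da ?Db//; exact: diff_derivable.
- have dp := @derivable_horner _ p (seval a y).
  split; first by have [] := derive_chain 0 da dp.
  move=> u; have [_ ->] := derive_chain u da dp.
  by rewrite Da derivE.
Qed.

Lemma near_neq0 y : y != 0 -> \forall z \near y, (z : E) != 0.
Proof.
move=> y0; apply: (@filterS _ (nbhs y) _ (~` [set (0 : E)])) => [z /eqP//|].
apply: open_nbhs_nbhs; split; last exact/eqP.
exact/closed_openC/accessible_closed_set1/hausdorff_accessible/norm_hausdorff.
Qed.

(** Expressions represent the extension and its iterated derivatives off the origin only, so
    differentiability has to pass between functions that agree near a point. *)
Lemma near_eq_differentiable (f g : E -> R) y : (\near y, f y = g y) ->
  differentiable g y -> differentiable f y.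
Proof.
move=> fg dg; have fgy : f y = g y := nbhs_singleton fg.
have cd : continuous ('d g y) by exact: diff_continuous.
have key : f \o shift y = cst (f y) + 'd g y +o_ (0 : E) id.
  apply/eqaddoP => e e0.
  have := (eqaddoP _ _ _ _).1 (diff_locally dg) _ e0.
  have : \forall h \near (0 : E), f (h + y) = g (h + y).
    by move: fg; rewrite (near_shift (0 : E)) subr0.
  apply: filterS2 => h fgh.
  by rewrite /= !fctE fgh fgy.
have dd : 'd f y = 'd g y :> (E -> R) by exact: diff_unique.
by apply/diff_locallyP; rewrite dd.
Qed.

Lemma derive_seval (f : E -> R) e u y : (forall y, y != 0 -> f y = seval e y) ->
  y != 0 -> 'D_u f y = seval (sderiv u e) y.
Proof.
move=> fe y0; rewrite -(seval_derive e y0).2.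
apply: near_eq_derive.
by apply: filterS (near_neq0 y0) => z; exact: fe.
Qed.

Lemma smooth_seval f e : (forall y, y != 0 -> homog_ext f y = seval e y) ->
  smooth_sphere f.
Proof.
move=> fe vs.
have [e' he'] : exists e', forall y, y != 0 ->
    foldr (fun v (g : E -> R) => 'D_v g) (homog_ext f) vs y = seval e' y.
  elim: vs => [|v vs [e' he']]; first by exists e.
  by exists (sderiv v e') => y y0 /=; exact: derive_seval.
move=> y y0; apply: near_eq_differentiable (seval_derive e' y0).1.
by apply: filterS (near_neq0 y0) => z; exact: he'.
Qed.

Section Zonal.
Variables (p : {poly R}) (v : E).

Let zonal x := p.[dot v x].
Let zexpr := SPol p (SMul SInv (SLin v)).

Let zonalE y : homog_ext zonal y = seval zexpr y.
Proof. by rewrite /homog_ext /zonal dotZr. Qed.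

Lemma smooth_zonal : smooth_sphere zonal.
Proof. by apply: (@smooth_seval _ zexpr) => y _; exact: zonalE. Qed.

(** Put s = v.x. At a unit vector x, the first derivative of v.y / |y| along e_i is v_i - s x_i and
    the second is - 2 v_i x_i - s + 3 s x_i^2. Summed over i, the squares of the former give 1 - s^2
    and the latter give - d s. For d = 2 l + 1 this is the Gegenbauer operator. *)
Lemma laplace_zonal x : S v -> S x ->
  laplace_beltrami zonal x =
  ((1 - 'X ^+ 2) * p^`()^`() - d%:R%:P * ('X * p^`())).[dot v x].
Proof.
move=> /sphereP Sv /sphereP Sx.
have x0 : x != 0.
  by apply: contra_eq_neq Sx => ->; rewrite /dot mul0mx mxE eq_sym oner_eq0.
have r1 : inv_norm x = 1 by rewrite /inv_norm /enorm Sx sqrtr1 invr1.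
rewrite /laplace_beltrami.
transitivity (\sum_(i < d.+1) (p^`()^`().[dot v x] * (v 0 i - dot v x * x 0 i) ^+ 2 +
   p^`().[dot v x] * (- 2 * (v 0 i * x 0 i) - dot v x + 3 * dot v x * (x 0 i * x 0 i)))).
  apply: eq_bigr => i _; set u := delta_mx 0 i.
  rewrite (@derive_seval _ (sderiv u zexpr))//; last first.
    by move=> y y0; apply: derive_seval => // z _; exact: zonalE.
  have dv : dot v u = v 0 i by rewrite dotC dot_delta.
  have du : dot u u = 1 by rewrite dot_delta mxE !eqxx.
  rewrite /= r1 dv du !dot_delta. rewrite !(mul1r (dot v x)); ring.
rewrite big_split -!mulr_sumr /=.
have -> : \sum_(i < d.+1) (v 0 i - dot v x * x 0 i) ^+ 2 = 1 - dot v x ^+ 2.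
  transitivity (dot v v - 2 * dot v x * dot v x + dot v x ^+ 2 * dot x x); last first.
    by rewrite Sv Sx; ring.
  rewrite (dotE v v) (dotE x x) [X in _ - _ * X](dotE v x) !mulr_sumr -sumrN -!big_split /=.
  by apply: eq_bigr => i _; ring.
have -> : \sum_(i < d.+1) (- 2 * (v 0 i * x 0 i) - dot v x + 3 * dot v x * (x 0 i * x 0 i))
    = - (d%:R * dot v x).
  rewrite !big_split /= -!mulr_sumr -!dotE sumrN sumr_const card_ord Sx.
  by rewrite -mulr_natl -natr1; ring.
rewrite !(hornerM, hornerD, hornerN, hornerC, hornerX, horner_exp); ring.
Qed.

End Zonal.

End SmoothExpressions.

(** * From an integral identity to exponential decay *)

Section ExpectationODE.
Context {R : realType} {dT : measure_display} {T : measurableType dT}.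
Variables (P : probability T R) (g : R -> T -> R) (c u0 H : R).
Local Notation mu := (@lebesgue_measure R).
Hypothesis gH : forall t w, 0 <= t -> `|g t w| <= H.
Hypothesis cg : forall w, {within `[0, +oo[, continuous (fun t => g t w)}.

Let V t w := \int[mu]_(s in `[0, t]) g s w.
Hypothesis mV : forall t, 0 <= t -> measurable_fun setT (V t).
Hypothesis integral_eq : forall t, 0 <= t ->
  \int[P]_w g t w = u0 - c * \int[P]_w V t w.

Let g_integrable t w : mu.-integrable `[0, t] (EFin \o (fun s => g s w)).
Proof.
apply: continuous_compact_integrable; first exact: segment_compact.
apply: (continuous_subspaceW _ (@cg w)) => s /=.
by rewrite !in_itv /= andbT => /andP[].
Qed.

Let V_bound t w : 0 <= t -> `|V t w| <= H * t.
Proof.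
move=> t0.
apply: (le_trans (le_normr_Rintegral _ (g_integrable t w))) => //.
apply: (@le_trans _ _ (\int[mu]_(s in `[0, t]) H)).
  apply: le_Rintegral => //.
  - by apply: integrable_norm; exact: g_integrable.
  - apply: continuous_compact_integrable; first exact: segment_compact.
    by apply: continuous_subspaceT => x; exact: cvg_cst.
  - by move=> s /=; rewrite in_itv /= => /andP[s0 _]; exact: gH.
rewrite Rintegral_cst//= lebesgue_measure_itv /= lte_fin.
case: ltP => [_|t0']; first by rewrite ?oppr0 ?subr0//= addr0.
by rewrite (le_anti (introT andP (conj t0' t0))) !mulr0.
Qed.

Let V_integrable t : 0 <= t -> P.-integrable setT (EFin \o V t).
Proof.
move=> t0; apply: (@ae_bounded_integrable _ _ _ _ _ (H * t)); first exact: mV.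
by apply: aeW => w; exact: V_bound.
Qed.

Let H0 : 0 <= H.
Proof.
(* A probability space has a point, at which the bound [gH] forces H >= 0. *)
have [w _] : [set: T] !=set0.
  apply/set0P/negP => /eqP e; have := @probability_setT _ _ _ P.
  by rewrite e measure0 => /eqP; rewrite eq_sym onee_eq0.
by rewrite (le_trans _ (@gH 0 w _)).
Qed.

Let V_derive (t : R) w : 0 < t -> is_derive t 1 (V ^~ w) (g t w).
Proof.
move=> t0; have tt : t < t + 1 by rewrite ltrDl.
have cgt : {for t, continuous (fun s => g s w)}.
  have /continuous_within_itvcyP[h _] := @cg w.
  by apply: h; rewrite in_itv /= andbT.
have [h1 h2] := continuous_FTC1_closed tt (g_integrable (t + 1) w) t0 cgt.
by apply: DeriveDef => //; rewrite -derive1E.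
Qed.

Let F t := \int[P]_w V t w.

(** Paths are continuous, so V has time derivative g, dominated by the constant H. Differentiation
    under the expectation then closes the equation through [integral_eq]. *)
Let F_derive (t : R) : 0 < t -> is_derive t 1 F (u0 - c * F t).
Proof.
move=> t0; rewrite /F -integral_eq; last exact: ltW.
have It : `]0, (t + 1)[%classic t by rewrite /= in_itv /= t0 ltrDl ltr01.
have intV x : `]0, (t + 1)[%classic x -> P.-integrable setT (EFin \o V x).
  by rewrite /= in_itv /= => /andP[x0 _]; apply: V_integrable; exact: ltW.
have derV x w : `]0, (t + 1)[%classic x -> setT w -> derivable (V ^~ w) x 1.
  by rewrite /= in_itv /= => /andP[x0 _] _; have [] := V_derive w x0.
have intH : P.-integrable setT (EFin \o (fun=> H)).
  by apply: finite_measure_integrable_cst.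
have bndV x w : `]0, (t + 1)[%classic x -> setT w -> `|partial1of2 V x w| <= H.
  rewrite /= in_itv /= => /andP[x0 _] _; rewrite /partial1of2 derive1E.
  by have [_ ->] := V_derive w x0; apply: gH; exact: ltW.
have d1 := derivable_under_integral measurableT It intV derV (fun=> H0) intH bndV.
have d2 := differentiation_under_integral measurableT It intV derV (fun=> H0) intH bndV.
apply: DeriveDef => //; rewrite -derive1E d2.
apply: eq_Rintegral => w _; rewrite /partial1of2 derive1E.
by have [] := V_derive w t0.
Qed.

Let F_bound t : 0 <= t -> `|F t| <= H * t.
Proof.
move=> t0; apply: (le_trans (le_normr_Rintegral _ (V_integrable t0))) => //.
apply: (@le_trans _ _ (\int[P]_w (H * t))).
  apply: le_Rintegral => //.
  - by apply: integrable_norm; exact: V_integrable.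
  - exact: finite_measure_integrable_cst.
  - by move=> w _; exact: V_bound.
by rewrite Rintegral_cst_probability.
Qed.

(* Only [V], the time integral of [g], is differentiated in [t]; this avoids any
   joint measurability of [g]. *)
Lemma expectation_ode t : 0 <= t -> \int[P]_w g t w = u0 * expR (- (c * t)).
Proof.
move=> t0; rewrite integral_eq// -/(F t).
(* Integrating factor: G is constant for F' = u0 - c F. This form avoids dividing by c. *)
pose G s := expR (c * s) * (c * F s - u0).
have F00 : F 0 = 0.
  by apply/eqP; rewrite -normr_le0 (le_trans (F_bound _))// mulr0.
have G0 : G 0 = - u0 by rewrite /G F00 !mulr0 expR0 mul1r sub0r.
suff Gt : G t = - u0.
  have : expR (- (c * t)) * G t = - (u0 * expR (- (c * t))) by rewrite Gt; ring.
  rewrite /G mulrA -expRD addNr expR0 mul1r => e.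
  by rewrite -opprB e opprK.
have [t1|] := ltP 0 t; last first.
  by move=> t0'; rewrite (le_anti (introT andP (conj t0' t0))) G0.
have dG (s : R) : 0 < s -> is_derive s 1 G 0.
  move=> s0; have dF := F_derive s0.
  rewrite /G; apply: is_derive_eq.
  rewrite -![_ *: _]/(_ * _); ring.
have [||x _] := @MVT _ G (fun=> 0) 0 t t1.
- by move=> x; rewrite in_itv /= => /andP[x0 _]; exact: dG.
- apply/continuous_within_itvP => //; split.
  + move=> x; rewrite in_itv /= => /andP[x0 _].
    by apply/differentiable_continuous/derivable1_diffP; have [] := dG _ x0.
  + have Hx0 : H * x @[x --> (0 : R)^'+] --> 0.
      rewrite -[X in _ --> X](mulr0 H); apply: cvg_at_right_filter.
      exact: mulrl_continuous.
    (* [F_derive] concerns positive times only. At 0, continuity comes from |F(x)| <= H x. *)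
    have F0 : F x @[x --> 0^'+] --> F 0.
      rewrite F00; apply: (@squeeze_cvgr _ _ _ _ (fun x => - (H * x)) (fun x => H * x)).
      * near=> x; have x0 : 0 <= x by near: x; exact: nbhs_right_ge.
        by rewrite -ler_norml; exact: F_bound.
      * by rewrite -[X in _ --> X]oppr0; apply: cvgN; exact: Hx0.
      * exact: Hx0.
    rewrite /G; apply: cvgM.
      by apply: cvg_at_right_filter; apply: (continuous_comp (f := fun x => c * x));
        [exact: mulrl_continuous|exact: continuous_expR].
    by apply: cvgB; [exact: cvgMr|exact: cvg_cst].
  + apply: cvg_at_left_filter.
    by apply/differentiable_continuous/derivable1_diffP; have [] := dG _ t1.
- by rewrite mul0r G0 => /eqP; rewrite subr_eq0 => /eqP.
Unshelve. all: by end_near. Qed.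

End ExpectationODE.

(** * Expectations along spherical Brownian motion *)

Section Brownian.
Context {R : realType} {d : nat} {dT : measure_display} {T : measurableType dT}.
Local Notation E := 'rV[R]_d.+1.
Local Notation S := (sphere R d).
Local Notation mu := (@lebesgue_measure R).
Variables (P : probability T R) (eta : E) (B : R -> T -> E).
Hypothesis hB : spherical_brownian_motion P eta B.

Lemma sbm_measurable_comp (f : E -> R) t : continuous f -> 0 <= t ->
  measurable_fun setT (fun w => f (B t w)).
Proof.
move=> cf t0; apply: (@measurableT_comp _ _ _ _ _ _ (f : borelE R d -> R) _ (B t)).
  exact: continuous_measurable_borelE.
exact: (sbm_measurable hB).
Qed.

Lemma sbm_integrable_comp (f : E -> R) t : continuous f -> 0 <= t ->
  P.-integrable setT (EFin \o (fun w => f (B t w))).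
Proof.
move=> cf t0; have [M fM] := continuous_sphere_bounded cf.
apply: (@ae_bounded_integrable _ _ _ _ _ M); first exact: sbm_measurable_comp.
by apply: aeW => w; apply: fM; exact: (sbm_sphere hB).
Qed.

Lemma sbm_start_ae : {ae P, forall w, B 0 w = eta}.
Proof.
apply: probability1_ae; last exact: (sbm_start hB).
rewrite -[X in measurable X]setTI.
have m0 := sbm_measurable hB (lexx 0).
apply: (m0 measurableT [set eta]).
rewrite -[X in measurable X]setCK; apply: measurableC; apply: measurable_open.
exact/closed_openC/accessible_closed_set1/hausdorff_accessible/norm_hausdorff.
Qed.

(** The martingale identity between times 0 and t on the whole space: the martingale vanishes at
    time 0. *)
Lemma sbm_dynkin (f : E -> R) t : smooth_sphere f -> continuous f -> 0 <= t ->
  \int[P]_w (f (B t w) - f (B 0 w)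
      - \int[mu]_(s in `[0, t]) (2^-1 * laplace_beltrami f (B s w))) = 0.
Proof.
move=> sf cf t0; have [_ _ h] := sbm_generator hB sf.
rewrite (h 0 t) //.
  apply: (etrans _ (Rintegral_cst_probability P 0)).
  apply: eq_Rintegral => w _.
  by rewrite subrr set_itv1 Rintegral_set1 subr0.
exact: (@measurableT _ (g_sigma_algebraType (\bigcup_(u in `[0, (0 : R)])
  preimage_set_system setT (B u : T -> borelE R d) measurable))).
Qed.

(** For f = C_n(v.x) the drift is - c f with c = n (n + 2 l) / 2, so the mean-zero identity becomes
    the integral equation solved by [expectation_ode]. *)
Lemma sbm_gegenbauer (l : R) n v t : 2 * l + 1 = d%:R -> 0 < l -> S v -> 0 <= t ->
  \int[P]_w (gegenbauer l n).[dot v (B t w)] =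
  (gegenbauer l n).[dot v eta] * heat l t n.
Proof.
move=> ld l0 Sv t0; set C := gegenbauer l n.
pose f x := C.[dot v x].
have cf : continuous f by exact/continuous_horner_fun/continuous_dot.
pose c := n%:R * (n%:R + 2 * l) / 2.
have -> : heat l t n = expR (- (c * t)) by rewrite /heat /c; congr expR; ring.
have [n0|n0] := eqVneq n 0%N.
  rewrite /c n0 mul0r mul0r mul0r oppr0 expR0 mulr1 /C n0.
  under eq_Rintegral do rewrite hornerC.
  by rewrite Rintegral_cst_probability hornerC.
have c0 : c != 0.
  by rewrite gt_eqF// divr_gt0// mulr_gt0 ?addr_gt0 ?mulr_gt0// ltr0n lt0n.
have [H fH] := continuous_sphere_bounded cf.
have laplE s w : 0 <= s -> 2^-1 * laplace_beltrami f (B s w) = - (c * f (B s w)).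
  move=> s0; rewrite laplace_zonal//; last exact: (sbm_sphere hB).
  by rewrite -ld gegenbauer_ode hornerM hornerN hornerC /c /f -/C; field.
have cpath w : {within `[0, +oo[, continuous (fun t => f (B t w))}.
  have cB : continuous ((fun t => B t w) : subspace `[0 : R, +oo[ -> E).
    exact: (sbm_continuous hB).
  by move=> s; apply: (@continuous_comp (subspace `[0 : R, +oo[) E R _ f); [exact: cB|exact: cf].
have intpath w s : mu.-integrable `[0, s] (EFin \o (fun r => f (B r w))).
  apply: continuous_compact_integrable; first exact: segment_compact.
  apply: (continuous_subspaceW _ (@cpath w)) => r /=.
  by rewrite !in_itv /= andbT => /andP[].
have driftE w s : \int[mu]_(r in `[0, s]) (2^-1 * laplace_beltrami f (B r w)) =
    - (c * \int[mu]_(r in `[0, s]) f (B r w)).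
  rewrite -mulNr -RintegralZl//.
  apply: eq_Rintegral => r; rewrite inE /= in_itv /= => /andP[r0 _].
  by rewrite laplE// mulNr.
pose M s w := f (B s w) - f (B 0 w)
      - \int[mu]_(r in `[0, s]) (2^-1 * laplace_beltrami f (B r w)).
have ME s w : M s w = f (B s w) - f (B 0 w) + c * \int[mu]_(r in `[0, s]) f (B r w).
  by rewrite /M driftE opprK.
have intM s : 0 <= s -> P.-integrable setT (EFin \o M s).
  by move=> s0; have [_ h _] := sbm_generator hB (smooth_zonal C v); exact: h.
(* The time integral inherits measurability in w from the martingale, by solving for it. This
   divides by c, hence the separate case n = 0. *)
have VE s w : \int[mu]_(r in `[0, s]) f (B r w) =
    c^-1 * (M s w - (f (B s w) - f (B 0 w))).
  by rewrite ME addrAC subrr add0r mulKf.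
have intV s : 0 <= s -> P.-integrable setT (EFin \o (fun w => \int[mu]_(r in `[0, s]) f (B r w))).
  move=> s0; rewrite (_ : _ \o _ = fun w => ((c^-1)%:E * (((EFin \o M s) \-
     ((EFin \o (fun w => f (B s w))) \- (EFin \o (fun w => f (B 0 w))))) w))%E).
    apply: integrableZl => //; apply: integrableB => //; first exact: intM.
    by apply: integrableB => //; exact: sbm_integrable_comp.
  by apply/funext => w /=; rewrite VE EFinM EFinB EFinB.
apply: (@expectation_ode _ _ _ P (fun s w => f (B s w)) c _ H) => //.
- by move=> s w s0; apply: fH; exact: (sbm_sphere hB).
- by move=> s /intV /integrableP[/measurable_EFinP].
- move=> s s0; have := sbm_dynkin (smooth_zonal C v) cf s0.
  under eq_Rintegral => w _ do rewrite -/(M s w) ME.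
  have i1 := sbm_integrable_comp cf s0; have i2 := sbm_integrable_comp cf (lexx 0).
  have i3 : P.-integrable setT (EFin \o (fun w => c * \int[mu]_(r in `[0, s]) f (B r w))).
    by rewrite (_ : _ \o _ = fun w => (c%:E * (\int[mu]_(r in `[0, s]) f (B r w))%:E)%E);
      [apply: integrableZl => //; exact: intV|].
  have i12 : P.-integrable setT (EFin \o (fun w => f (B s w) - f (B 0 w))).
    by apply: eq_integrable (integrableB _ i1 i2) => //.
  rewrite RintegralD// RintegralB// RintegralZl//; last exact: intV.
  have -> : \int[P]_w f (B 0 w) = f eta.
    rewrite -(Rintegral_cst_probability P (f eta)); apply: ae_eq_Rintegral => //.
    - exact: sbm_measurable_comp.
    - by apply: sub_ae sbm_start_ae => w ->.
  move=> e; rewrite -/(f eta); lra.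
Qed.

End Brownian.

(** * Identification of the law *)

Section Distance.
Context {R : realType} {E : normedModType R}.
Implicit Types (x y a : E) (A : set E).

Definition set_dist A x : R := inf [set `|x - a| | a in A].

Let dist_lb A x : lbound [set `|x - a| | a in A] 0.
Proof. by move=> _ [a _ <-]. Qed.

Let dist_has_lb A x : has_lbound [set `|x - a| | a in A].
Proof. by exists 0; exact: dist_lb. Qed.

Lemma set_dist_triangle A x y : A !=set0 ->
  set_dist A x <= `|x - y| + set_dist A y.
Proof.
move=> [a0 Aa0]; rewrite -lerBlDl; apply: lb_le_inf.
  by exists `|y - a0|, a0.
move=> _ [a Aa <-]; rewrite lerBlDl.
apply: (@le_trans _ _ `|x - a|); first by apply: ge_inf => //; exists a.
by rewrite (le_trans _ (ler_normD _ _))// addrA subrK.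
Qed.

Lemma set_dist_ge0 A x : 0 <= set_dist A x.
Proof.
have [->|/set0P[a Aa]] := eqVneq A set0; first by rewrite /set_dist image_set0 inf0.
by apply: lb_le_inf => //; exists `|x - a|, a.
Qed.

Lemma set_dist_mem A x : A x -> set_dist A x = 0.
Proof.
move=> Ax; apply/eqP; rewrite eq_le set_dist_ge0 andbT.
by apply: ge_inf => //; exists x; rewrite ?subrr ?normr0.
Qed.

Lemma set_dist_gt0 A x : A !=set0 -> open (~` A) -> ~ A x -> 0 < set_dist A x.
Proof.
move=> [a0 Aa0] oA nAx.
have /nbhs_ballP[r /= r0 hr] : nbhs x (~` A) by apply: open_nbhs_nbhs.
apply: (lt_le_trans r0); apply: lb_le_inf; first by exists `|x - a0|, a0.
move=> _ [a Aa <-]; rewrite leNgt; apply/negP => xa.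
by apply: (hr a) => //; rewrite -ball_normE.
Qed.

Lemma continuous_set_dist A : A !=set0 -> continuous (set_dist A).
Proof.
move=> A0 x; apply/cvgrPdist_lt => e e0; near=> y.
apply: (@le_lt_trans _ _ `|x - y|).
  rewrite ler_norml lerBlDr set_dist_triangle// andbT.
  by rewrite lerBrDr addrC lerBlDr addrC distrC set_dist_triangle.
near: y; apply/nbhs_ballP; exists e => // y.
by rewrite -ball_normE.
Unshelve. all: by end_near. Qed.

(** Continuous functions with values in [0, 1] that vanish off A and tend to 1 at the points of an
    open A, as j grows, provided the complement is nonempty. *)
Definition open_approx (A : set E) (j : nat) (x : E) : R :=
  1 - (1 + j%:R * set_dist (~` A) x)^-1.

Let den_ge1 A j x : 1 <= 1 + j%:R * set_dist (~` A) x.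
Proof. by rewrite lerDl mulr_ge0// set_dist_ge0. Qed.

Lemma open_approx_bounds A j x : 0 <= open_approx A j x <= 1.
Proof.
have h := den_ge1 A j x; have h0 := lt_le_trans ltr01 h.
rewrite /open_approx subr_ge0 invf_le1// h /= gerBl.
by rewrite invr_ge0 ltW.
Qed.

Lemma continuous_open_approx A j : ~` A !=set0 -> continuous (open_approx A j).
Proof.
move=> A0; apply: continuousB_fun; first exact: cst_continuous.
move=> x; apply: cvgV; first by rewrite gt_eqF// (lt_le_trans ltr01).
have cd : continuous (fun x => 1 + j%:R * set_dist (~` A) x).
  apply: continuousD_fun; first exact: cst_continuous.
  apply: continuousM_fun; first exact: cst_continuous.
  exact: continuous_set_dist.
exact: cd.
Qed.

Lemma open_approx_cvg A x : ~` A !=set0 -> open A ->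
  open_approx A j x @[j --> \oo] --> (\1_A x : R).
Proof.
move=> A0 oA; rewrite indicE; have [Ax|nAx] := boolP (x \in A); last first.
  have -> : (fun j => open_approx A j x) = cst 0.
    apply/funext => j; rewrite /open_approx set_dist_mem ?mulr0 ?addr0 ?invr1 ?subrr//.
    by move=> /mem_set; apply/negP.
  exact: cvg_cst.
have D0 : 0 < set_dist (~` A) x.
  apply: set_dist_gt0 => //; first by rewrite setCK.
  by move=> /(_ (set_mem Ax)).
rewrite /open_approx -[X in _ --> X]subr0; apply: cvgB; first exact: cvg_cst.
apply: (@squeeze_cvgr _ _ _ _ (cst 0) (fun j => (set_dist (~` A) x)^-1 * j%:R^-1)).
- near=> j; have j0 : 0 < j%:R :> R by rewrite ltr0n; near: j; exact: nbhs_infty_gt.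
  rewrite invr_ge0 (le_trans ler01)//= -invfM lef_pV2 ?posrE ?mulr_gt0//.
    by rewrite mulrC lerDr.
  by rewrite (lt_le_trans ltr01).
- exact: cvg_cst.
- rewrite -[X in _ --> X](mulr0 (set_dist (~` A) x)^-1); apply: cvgMr.
  apply: (gtr0_cvgV0 _).2; last exact: cvgr_idn.
  by near=> j; rewrite ltr0n; near: j; exact: nbhs_infty_gt.
Unshelve. all: by end_near. Qed.

End Distance.

(** A summable majorant: one power of 5 + 6 l bounds C_n, the other comes from the error in
    [kernel_coef_close]. *)
Definition heat_weight {R : realType} (l t : R) n : R :=
  (1 + n%:R / l) * (5 + 6 * l) ^+ n * (5 + 6 * l) ^+ n * heat l t n.

Definition heat_bound {R : realType} (l t : R) : R := limn (series (heat_weight l t)).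

(** * The heat kernel series and its approximation by kernel expectations *)

Section Law.
Context {R : realType} {d : nat} {dT : measure_display} {T : measurableType dT}.
Local Notation E := 'rV[R]_d.+1.
Local Notation S := (sphere R d).
Variable unif : probability (borelE R d) R.
Hypothesis hunif : is_unif_sphere unif.
Variables (P : probability T R) (eta : E) (B : R -> T -> E).
Hypothesis heta : S eta.
Hypothesis hB : spherical_brownian_motion P eta B.
Variables (l t : R).
Hypothesis ld : 2 * l + 1 = d%:R.
Hypothesis hl : 1 <= 2 * l.
Hypothesis t_gt0 : 0 < t.

Local Notation C := (gegenbauer l).
Local Notation J f := (\int[unif]_x f x).
Local Notation K := (kernel_poly unif).
Let l0 : 0 < l. Proof. by move: hl; lra. Qed.
Let t0 : 0 <= t. Proof. exact: ltW. Qed.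
Local Notation sigma := (5 + 6 * l).
Local Notation weight := (heat_weight l t).
Local Notation G := (heat_bound l t).
Let sigma1 : 1 <= sigma. Proof. by move: l0; lra. Qed.

(* The indicator makes the series converge outside of the sphere as well. *)
Definition heat_term n (x : E) : R :=
  \1_S x * ((1 + n%:R / l) * heat l t n * (C n).[dot eta x]).

Definition heat_kernel (x : E) : R := limn (series (heat_term ^~ x)).

Let weight_ge0 n : 0 <= weight n.
Proof.
have /andP[w0 _] := weight_bounds n l0.
rewrite /heat_weight; apply: mulr_ge0; last exact: heat_ge0.
by rewrite -mulrA mulr_ge0// mulr_ge0// exprn_ge0// (le_trans ler01).
Qed.

Let weight_le n : `|weight n| <= ((1 + l^-1) * (sigma * sigma)) ^+ n * heat l t n.
Proof.
rewrite ger0_norm// /heat_weight ler_wpM2r ?heat_ge0// -mulrA -exprMn [leRHS]exprMn.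
have /andP[_ w1] := weight_bounds n l0.
by rewrite ler_wpM2r// exprn_ge0// mulr_ge0// (le_trans ler01).
Qed.

Let r_gt0 : 0 < (1 + l^-1) * (sigma * sigma).
Proof.
have s0 := lt_le_trans ltr01 sigma1.
by rewrite mulr_gt0 ?mulr_gt0// addr_gt0// invr_gt0.
Qed.

Let cvg_weight : cvgn (series weight).
Proof. exact: (cvg_series_heat (ltW l0) t_gt0 r_gt0 weight_le). Qed.

Let G_ge0 : 0 <= G.
Proof. by rewrite (le_trans (weight_ge0 0))// term_le_lim_series. Qed.

Lemma heat_term_le n x : `|heat_term n x| <= weight n.
Proof.
rewrite /heat_term indicE; have [xS|] := boolP (x \in S); last first.
  by rewrite mul0r normr0.
rewrite mul1r; have [c1 _] := gegenbauer_bounds n (ltW l0) (dot_sphere_norm heta (set_mem xS)).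
have /andP[w0 _] := weight_bounds n l0.
rewrite normrM normrM (ger0_norm w0) (ger0_norm (heat_ge0 _ _ _)) /heat_weight.
rewrite (_ : _ * sigma ^+ n * _ * _ =
  (1 + n%:R / l) * heat l t n * (sigma ^+ n * sigma ^+ n)); last by ring.
rewrite ler_wpM2l ?(mulr_ge0 w0) ?heat_ge0// (le_trans c1)//.
by rewrite -[leLHS]mulr1 ler_wpM2l ?exprn_ege1// exprn_ge0// (le_trans ler01).
Qed.

Lemma cvg_heat_kernel x : series (heat_term ^~ x) @ \oo --> heat_kernel x.
Proof.
apply: (cvg_series_heat (ltW l0) t_gt0 r_gt0) => n.
by rewrite (le_trans (heat_term_le n x))// (le_trans _ (weight_le n))// ger0_norm.
Qed.

Lemma measurable_heat_term n : measurable_fun setT (heat_term n : borelE R d -> R).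
Proof.
apply: measurable_funM; first exact: measurable_indic measurable_sphere.
apply: measurable_funM => //; apply: continuous_measurable_borelE.
exact/continuous_horner_fun/continuous_dot.
Qed.

Lemma measurable_heat_partial N :
  measurable_fun setT (fun x : borelE R d => series (heat_term ^~ x) N).
Proof.
rewrite /series /=; apply: measurable_sum => n; exact: measurable_heat_term.
Qed.

Lemma measurable_heat_kernel : measurable_fun setT (heat_kernel : borelE R d -> R).
Proof.
apply: (@measurable_fun_cvg _ _ _ setT (fun N (x : borelE R d) => series (heat_term ^~ x) N)).
- exact: measurable_heat_partial.
- by move=> x _; exact: cvg_heat_kernel.
Qed.

Lemma heat_partial_le N x : `|series (heat_term ^~ x) N| <= G.
Proof.
rewrite /series /= (le_trans (ler_norm_sum _ _ _))//.
rewrite (le_trans _ (le_lim_series N weight_ge0 cvg_weight))//.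
by rewrite big_mkord ler_sum// => n _; exact: heat_term_le.
Qed.

Lemma heat_kernel_le x : `|heat_kernel x| <= G.
Proof.
have h : `|series (heat_term ^~ x) N| @[N --> \oo] --> `|heat_kernel x|.
  by apply: cvg_norm; exact: cvg_heat_kernel.
apply: (cvgr_to_le h); apply: nearW => N; exact: heat_partial_le.
Qed.

Local Notation tail := (@kernel_tail R d).

(** The finite expansion of K_k is compared term by term with the N-th partial sum. The term n
    differs by at most [tail k] times [weight n], so the bound survives N -> oo. *)
Lemma brownian_kernel_close k v : S v ->
  `|\int[P]_w (K k).[dot v (B t w)] - heat_kernel v| <= tail k * G.
Proof.
move=> Sv.
have [N0 hN0] := gegenbauer_expansion hunif ld hl (K k).
have EK N : (N0 <= N)%N -> \int[P]_w (K k).[dot v (B t w)] =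
    \sum_(n < N) gegenbauer_coef unif l (K k) n * ((C n).[dot eta v] * heat l t n).
  move=> N0N; pose F n w := gegenbauer_coef unif l (K k) n * (C n).[dot v (B t w)].
  have iC n : P.-integrable setT (EFin \o (fun w => (C n).[dot v (B t w)])).
    apply: (sbm_integrable_comp hB (f := fun x => (C n).[dot v x])) => //.
    exact/continuous_horner_fun/continuous_dot.
  transitivity (\int[P]_w \sum_(n < N) F n w).
    apply: eq_Rintegral => w _; rewrite {1}(hN0 _ N0N) horner_sum.
    by apply: eq_bigr => n _; rewrite hornerZ.
  rewrite Rintegral_ord_sum.
    apply: eq_bigr => n _; rewrite /F RintegralZl//.
    by rewrite (sbm_gegenbauer hB) // dotC.
  move=> n; rewrite (_ : _ \o _ =
    fun w => ((gegenbauer_coef unif l (K k) n)%:E * ((C n).[dot v (B t w)])%:E)%E) //.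
  exact: (integrableZl measurableT _ (iC n)).
have h : (fun N => `|\int[P]_w (K k).[dot v (B t w)] - series (heat_term ^~ v) N|)
   @ \oo --> `|\int[P]_w (K k).[dot v (B t w)] - heat_kernel v|.
  by apply: cvg_norm; apply: cvgB; [exact: cvg_cst|exact: cvg_heat_kernel].
apply: (cvgr_to_le h); near=> N.
rewrite (EK N); last by near: N; exact: nbhs_infty_ge.
rewrite /series /= big_mkord -sumrB (le_trans (ler_norm_sum _ _ _))//.
apply: (@le_trans _ _ (\sum_(n < N) tail k * weight n)); last first.
  rewrite -mulr_sumr ler_wpM2l ?divr_ge0//.
  exact: le_lim_series.
apply: ler_sum => n _.
rewrite /heat_term indicE mem_set// mul1r.
have := kernel_coef_close hunif ld hl k n.
set a := gegenbauer_coef _ _ _ _; set b := 1 + _ => ab.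
have [c1 _] := gegenbauer_bounds n (ltW l0) (dot_sphere_norm heta Sv).
have -> : a * ((C n).[dot eta v] * heat l t n) - b * heat l t n * (C n).[dot eta v] =
  (a - b) * (C n).[dot eta v] * heat l t n by ring.
rewrite !normrM (ger0_norm (heat_ge0 _ _ _)).
rewrite /heat_weight -/b mulrA ler_wpM2r ?heat_ge0//.
rewrite mulrA ler_pM//.
by rewrite mulrC.
Unshelve. all: by end_near. Qed.

End Law.

(** * Fubini for bounded functions on probability spaces *)

Section BoundedFubini.
Context {R : realType} {d1 d2 : measure_display}.
Context {T1 : measurableType d1} {T2 : measurableType d2}.
Variables (P1 : probability T1 R) (P2 : probability T2 R).

(** Measurability of the inner integrals is part of the conclusion because they later serve as
    integrands in limits and estimates. *)
Lemma Rintegral_swap (F : T1 * T2 -> R) (M : R) : 0 <= M ->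
  measurable_fun setT F -> (forall z, `|F z| <= M) ->
  [/\ measurable_fun setT (fun x => \int[P2]_y F (x, y)),
      measurable_fun setT (fun y => \int[P1]_x F (x, y)) &
      \int[P2]_y \int[P1]_x F (x, y) = \int[P1]_x \int[P2]_y F (x, y)].
Proof.
move=> M0 mF FM.
have int1 y : P1.-integrable setT (EFin \o (fun x => F (x, y))).
  apply: (@ae_bounded_integrable _ _ _ _ _ M); last exact: aeW.
  exact: measurableT_comp mF (measurable_pair2 y).
have int2 x : P2.-integrable setT (EFin \o (fun y => F (x, y))).
  apply: (@ae_bounded_integrable _ _ _ _ _ M); last exact: aeW.
  exact: measurableT_comp mF (measurable_pair1 x).
have intF : (P1 \x P2)%E.-integrable setT (EFin \o F).
  apply: measurable_bounded_integrable => //.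
    have e := product_measure1E P1 P2 (@measurableT _ T1) (@measurableT _ T2).
    rewrite setXTT [X in _ = (X * _)%E]probability_setT in e.
    rewrite [X in _ = (_ * X)%E]probability_setT mule1 in e.
    by rewrite [X in (X < _)%E]e ltry.
  exists M; split; [exact: num_real|move=> r Mr z _]; exact: (le_trans (FM z) (ltW Mr)).
have mf := @fine_measurable R setT measurableT.
split.
- exact: measurableT_comp mf (measurable_fubini_F intF).
- exact: measurableT_comp mf (measurable_fubini_G intF).
rewrite /Rintegral; congr fine.
have := @Fubini _ _ _ _ R P1 P2 (EFin \o F) intF.
move=> e; transitivity (\int[P2]_y \int[P1]_x (F (x, y))%:E)%E.
  apply: eq_integral => y _; rewrite fineK//. exact: (integrable_fin_num _ (int1 y)).
rewrite -e; apply: eq_integral => x _.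
rewrite fineK//; exact: (integrable_fin_num _ (int2 x)).
Qed.

End BoundedFubini.

Lemma horner_bounded {R : realType} (p : {poly R}) :
  exists2 M, 0 <= M & forall s, `|s| <= 1 -> `|p.[s]| <= M.
Proof.
exists (\sum_(i < size p) `|p`_i|); first exact: sumr_ge0.
move=> s s1; rewrite horner_coef (le_trans (ler_norm_sum _ _ _))// ler_sum// => i _.
by rewrite normrM -[leRHS]mulr1 ler_wpM2l// normrX exprn_ile1.
Qed.

(** * The heat kernel as the density of the law *)

Section Law.
Context {R : realType} {d : nat} {dT : measure_display} {T : measurableType dT}.
Local Notation E := 'rV[R]_d.+1.
Local Notation S := (sphere R d).
Variable unif : probability (borelE R d) R.
Hypothesis hunif : is_unif_sphere unif.
Variables (P : probability T R) (eta : E) (B : R -> T -> E).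
Hypothesis heta : S eta.
Hypothesis hB : spherical_brownian_motion P eta B.
Variables (l t : R).
Hypothesis ld : 2 * l + 1 = d%:R.
Hypothesis hl : 1 <= 2 * l.
Hypothesis t_gt0 : 0 < t.

Local Notation J f := (\int[unif]_x f x).
Local Notation K := (kernel_poly unif).
Local Notation h := (heat_kernel eta l t).
Local Notation tail := (@kernel_tail R d).
Let t0 : 0 <= t. Proof. exact: ltW. Qed.

Lemma kernel_fubini (f : E -> R) k : continuous f ->
  [/\ measurable_fun setT
        ((fun v => \1_S v * (f v * \int[P]_w (K k).[dot v (B t w)])) : borelE R d -> R),
      measurable_fun setT (fun w => J (fun v => f v * (K k).[dot (B t w) v])) &
      \int[P]_w J (fun v => f v * (K k).[dot (B t w) v]) =
      J (fun v => \1_S v * (f v * \int[P]_w (K k).[dot v (B t w)]))].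
Proof.
move=> cf; have [M fM] := continuous_sphere_bounded cf.
have M0 : 0 <= M by rewrite (le_trans _ (fM _ heta)).
have [N N0 KN] := horner_bounded (K k).
(* [Rintegral_swap] asks for a bound at every point. The indicator removes the v off the sphere,
   where the argument of K_k may leave [-1, 1]. *)
pose F (z : borelE R d * T) : R := \1_S z.1 * (f z.1 * (K k).[dot z.1 (B t z.2)]).
have mfst : measurable_fun setT (fst : borelE R d * T -> borelE R d) by exact: measurable_fst.
have msnd : measurable_fun setT (snd : borelE R d * T -> T) by exact: measurable_snd.
have mF : measurable_fun setT F.
  apply: measurable_funM.
    apply: (@measurableT_comp _ _ _ _ _ _ (\1_S : borelE R d -> R)) => //.
    exact: measurable_indic measurable_sphere.
  apply: measurable_funM.
    apply: (@measurableT_comp _ _ _ _ _ _ (f : borelE R d -> R)) => //.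
    exact: continuous_measurable_borelE.
  apply: (measurableT_comp (continuous_measurable_fun (@continuous_horner _ (K k)))).
  (* Joint measurability is checked through coordinates, as a finite sum of products of functions of
     one variable each. *)
  rewrite (_ : (fun _ => _) = fun z : borelE R d * T => \sum_i z.1 0 i * B t z.2 0 i); last first.
    by apply/funext => z; rewrite dotE.
  apply: measurable_sum => i; apply: measurable_funM.
    apply: (@measurableT_comp _ _ _ _ _ _ (fun x : borelE R d => (x : E) 0 i)) => //.
    exact: (continuous_measurable_borelE (@continuous_coord R d i)).
  apply: (@measurableT_comp _ _ _ _ _ _ (fun w : T => B t w 0 i)) => //.
  exact: (sbm_measurable_comp hB (@continuous_coord _ _ i)).
have FM z : `|F z| <= M * N.
  rewrite /F indicE; have [zS|] := boolP (z.1 \in S); last first.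
    by rewrite mul0r normr0 mulr_ge0.
  rewrite mul1r normrM ler_pM//; first exact/fM/set_mem.
  by apply/KN/dot_sphere_norm; [exact: set_mem|exact: (sbm_sphere hB)].
have cK w : continuous (fun v => (K k).[dot (B t w) v]).
  exact/continuous_horner_fun/continuous_dot.
have cfK w : continuous (fun v => f v * (K k).[dot (B t w) v]).
  exact: continuousM_fun.
have iK v : P.-integrable setT (EFin \o (fun w => (K k).[dot v (B t w)])).
  apply: (sbm_integrable_comp hB (f := fun x => (K k).[dot v x])) => //.
  exact/continuous_horner_fun/continuous_dot.
have EF v : \int[P]_w F (v, w) = \1_S v * (f v * \int[P]_w (K k).[dot v (B t w)]).
  rewrite /F /= mulrA -RintegralZl//.
  by apply: eq_Rintegral => w _; rewrite mulrA.
have MN0 : 0 <= M * N by exact: mulr_ge0.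
have [mEF mFE swap] := @Rintegral_swap _ _ _ _ _ unif P F (M * N) MN0 mF FM.
have EF' : (fun v => \int[P]_w F (v, w)) =
    fun v => \1_S v * (f v * \int[P]_w (K k).[dot v (B t w)]).
  exact/funext.
have JF : (fun w => J (fun v => f v * (K k).[dot (B t w) v])) =
    fun w => \int[unif]_v F (v, w).
  apply/funext => w; apply: ae_eq_Rintegral.
  - exact: continuous_measurable_borelE.
  - exact: measurableT_comp mF (measurable_pair2 w).
  - apply: sub_ae (unif_ae_sphere hunif) => v Sv.
    by rewrite /F /= indicE mem_set// mul1r (dotC v).
by rewrite -EF' JF; split.
Qed.

Lemma expectation_continuous (f : E -> R) : continuous f ->
  \int[P]_w f (B t w) = J (fun v => f v * h v).
Proof.
move=> cf; have [M fM] := continuous_sphere_bounded cf.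
have M0 : 0 <= M by rewrite (le_trans _ (fM _ heta)).
(* This sequence has two limits: directly, by the approximate identity at B_t, and after Fubini, by
   [brownian_kernel_close]. *)
pose a k := \int[P]_w J (fun v => f v * (K k).[dot (B t w) v]).
have a1 : a k @[k --> \oo] --> \int[P]_w f (B t w).
  apply: (@bounded_cvg_Rintegral _ _ _ P _ _ M).
  - by move=> k; have [_] := kernel_fubini k cf.
  - exact: (sbm_measurable_comp hB).
  - apply: aeW => w k; apply: kernel_average_le => //; exact: (sbm_sphere hB).
  - apply: aeW => w; apply: kernel_average_cvg => //; exact: (sbm_sphere hB).
have mh : measurable_fun setT (h : borelE R d -> R).
  exact: (measurable_heat_kernel heta hl t_gt0).
have hle := heat_kernel_le heta hl t_gt0.
have hclose := brownian_kernel_close hunif heta hB ld hl t_gt0.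
set G := heat_bound l t in hle hclose.
have G0 : 0 <= G by rewrite (le_trans _ (hle eta)).
have mfh : measurable_fun setT ((fun v => f v * h v) : borelE R d -> R).
  by apply: measurable_funM => //; exact: continuous_measurable_borelE.
have ifh : unif.-integrable setT (EFin \o (fun v => f v * h v)).
  apply: (@unif_integrable _ _ _ hunif _ (M * G)) => // v Sv.
  by rewrite normrM ler_pM// fM.
have bnd k : `|a k - J (fun v => f v * h v)| <= M * G * tail k.
  have [m1 _] := kernel_fubini k cf; rewrite /a => ->.
  set phi := (fun v => \1_S v * _) in m1 *.
  have tk0 : 0 <= tail k :> R by rewrite divr_ge0.
  have close v : S v -> `|phi v - f v * h v| <= M * G * tail k.
    move=> Sv; rewrite /phi indicE mem_set// mul1r -mulrBr normrM -mulrA ler_pM// ?fM//.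
    by rewrite mulrC; exact: hclose.
  have iphi : unif.-integrable setT (EFin \o phi).
    apply: (@unif_integrable _ _ _ hunif _ (M * G * tail k + M * G)) => // v Sv.
    rewrite -[phi v](subrK (f v * h v)) (le_trans (ler_normD _ _))// lerD ?close//.
    by rewrite normrM ler_pM// fM.
  rewrite -RintegralB//; apply: ae_Rintegral_norm_le.
  - by rewrite mulr_ge0// mulr_ge0.
  - exact: measurable_funB.
  - by apply: sub_ae (unif_ae_sphere hunif) => v /close.
have a2 : a k @[k --> \oo] --> J (fun v => f v * h v).
  apply/cvgrPdist_le => e e0; near=> k; rewrite distrC (le_trans (bnd k))//.
  near: k.
  have : M * G * tail k @[k --> \oo] --> 0.
    by rewrite -[X in _ --> X](mulr0 (M * G)); apply: cvgMr; exact: kernel_tail_cvg0.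
  by move=> /cvgr_le; apply.
exact: (cvg_unique _ a1 a2).
Unshelve. all: by end_near. Qed.

Lemma measurable_brownian_preimage (A : set (borelE R d)) : measurable A ->
  measurable (B t @^-1` A).
Proof.
move=> mA; rewrite -[X in measurable X]setTI.
exact: (sbm_measurable hB t0 measurableT).
Qed.

Let mh : measurable_fun setT (h : borelE R d -> R).
Proof. exact: (measurable_heat_kernel heta hl t_gt0). Qed.

Let ih : unif.-integrable setT (EFin \o h).
Proof. by apply: (unif_integrable hunif mh) => v _; exact: (heat_kernel_le heta hl t_gt0). Qed.

Lemma integral_heat_kernel (A : set (borelE R d)) : measurable A ->
  (\int[unif]_(x in A) (h x)%:E)%E = (J (fun v => \1_A v * h v))%:E.
Proof.
move=> mA.
have -> : (\int[unif]_(x in A) (h x)%:E = \int[unif]_x (\1_A x * h x)%:E)%E.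
  rewrite integral_mkcond; apply: eq_integral => x _.
  by rewrite patchE indicE; case: ifP => _; rewrite ?mul1r ?mul0r.
have iAh : unif.-integrable setT (EFin \o (fun v => \1_A v * h v)).
  rewrite (_ : _ \o _ = (EFin \o h) \_ A).
    by apply: (integrable_mkcond _ mA).1; apply: integrableS ih.
  by apply/funext => x; rewrite /= patchE indicE; case: ifP => _; rewrite ?mul1r ?mul0r.
by rewrite -[LHS]fineK//; exact: (integrable_fin_num _ iAh).
Qed.

Lemma law_indic (A : set (borelE R d)) : measurable A ->
  \int[P]_w (\1_A (B t w)) = J (fun v => \1_A v * h v) ->
  P (B t @^-1` A) = (\int[unif]_(x in A) (h x)%:E)%E.
Proof.
move=> mA e; have mBA := measurable_brownian_preimage mA.
rewrite integral_heat_kernel// -e.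
have -> : P (B t @^-1` A) = (\int[P]_w (\1_(B t @^-1` A) w)%:E)%E.
  by rewrite integral_indic// setIT.
have iA : P.-integrable setT (EFin \o (\1_(B t @^-1` A) : T -> R)).
  exact: integrable_indic.
by rewrite -[LHS]fineK//; exact: (integrable_fin_num _ iA).
Qed.

Lemma law_open (A : set (borelE R d)) : open (A : set E) ->
  P (B t @^-1` A) = (\int[unif]_(x in A) (h x)%:E)%E.
Proof.
move=> oA; have mA := measurable_open oA; apply: law_indic => //.
have m1A : measurable_fun setT (\1_A : borelE R d -> R) by exact: measurable_indic.
have m1B : measurable_fun setT (fun w => \1_A (B t w) : R).
  exact: (measurableT_comp m1A (sbm_measurable hB t0)).
(* With empty complement the distance is the infimum of the empty set, 0 by default, and the
   approximants vanish. The whole space is handled by f = 1. *)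
have [A0|/set0P A0] := eqVneq (~` A) set0.
  have -> : A = setT by rewrite -(setCK A) A0 setC0.
  rewrite indicT; apply: (@expectation_continuous (cst 1)).
  exact: cst_continuous.
have fb j x : `|open_approx (A : set E) j x| <= 1.
  by have /andP[f0 f1] := open_approx_bounds (A : set E) j x; rewrite ger0_norm.
have cf j : continuous (open_approx (A : set E) j) by exact: continuous_open_approx.
have a1 : \int[P]_w open_approx (A : set E) j (B t w) @[j --> \oo] --> \int[P]_w (\1_A (B t w)).
  apply: (@bounded_cvg_Rintegral _ _ _ P _ _ 1) => //.
  - by move=> j; exact: (sbm_measurable_comp hB (cf j)).
  - exact: aeW.
  - by apply: aeW => w; exact: open_approx_cvg.
have hle := heat_kernel_le heta hl t_gt0.
set G := heat_bound l t in hle.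
have a2 : J (fun v => open_approx (A : set E) j v * h v) @[j --> \oo] --> J (fun v => \1_A v * h v).
  apply: (@bounded_cvg_Rintegral _ _ _ unif _ _ G) => //.
  - by move=> j; apply: measurable_funM => //; exact: continuous_measurable_borelE.
  - exact: measurable_funM.
  - apply: aeW => v j; rewrite normrM -[G]mul1r ler_pM//; exact: fb.
  - apply: aeW => v; apply: cvgM; [exact: open_approx_cvg|exact: cvg_cst].
have e : (fun j => \int[P]_w open_approx (A : set E) j (B t w)) =
    fun j => J (fun v => open_approx (A : set E) j v * h v).
  by apply/funext => j; rewrite expectation_continuous.
by rewrite e in a1; exact: (cvg_unique _ a1 a2).
Qed.

(** Open sets are stable under intersection and generate the Borel sets. The right side is the
    integral of a real function given without a sign, so closure under complements and disjoint
    unions is derived from its integrability. *)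
Lemma law_borel (A : set (borelE R d)) : measurable A ->
  P (B t @^-1` A) = (\int[unif]_(x in A) (h x)%:E)%E.
Proof.
move=> mA; have ihS D : measurable D -> unif.-integrable D (EFin \o h).
  by move=> mD; apply: integrableS ih.
apply: (@dynkin_induction _ (borelE R d) (@open E)
  (fun A => P (B t @^-1` A) = (\int[unif]_(x in A) (h x)%:E)%E)) mA => //.
- by move=> C D; exact: openI.
- by apply: law_open; exact: openT.
- by move=> C oC; exact: law_open.
- move=> D mD PD; rewrite preimage_setC probability_setC ?PD; last first.
    exact: measurable_brownian_preimage.
  (* The total mass of the density is read off from the whole space, which is open. *)
  have e : (\int[unif]_x (h x)%:E = 1)%E.
    rewrite -law_open; last exact: openT.
    by rewrite preimage_setT probability_setT.
  rewrite -e -(setUv D) integral_setU_EFin//.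
  + rewrite addeAC subee ?add0e//.
    exact: (integrable_fin_num mD (ihS _ mD)).
  + exact: measurableC.
  + by rewrite setUv.
  + by apply/disj_set2P; rewrite setICr.
- move=> F mF tF PF.
  rewrite integral_bigcup//; last by apply: ihS; exact: bigcup_measurable.
  rewrite preimage_bigcup.
  have mBF n : measurable (B t @^-1` F n) by exact: measurable_brownian_preimage.
  have tBF : trivIset setT (fun n => B t @^-1` F n).
    by move=> i j _ _ [w [Fi Fj]]; apply: tF => //; exists (B t w).
  have h1 := measure_semi_sigma_additive _ mBF tBF (bigcupT_measurable _ mBF).
  rewrite -(cvg_lim _ (h1 R P))//.
  by congr (limn _); apply/funext => n; apply: eq_bigr => i _; exact: PF.
Qed.

End Law.

(** * The mixture as a rearrangement of the heat kernel series *)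

Section Mixture.
Context {R : realType} {d : nat}.
Local Notation E := 'rV[R]_d.+1.
Local Notation S := (sphere R d).
Variable unif : probability (borelE R d) R.
Hypothesis hunif : is_unif_sphere unif.
Variables (eta : E) (l t : R) (m : nat).
Hypothesis heta : S eta.
Hypothesis lm : 2 * l = m.+1%:R.
Hypothesis t_gt0 : 0 < t.
Variable A : set (borelE R d).
Hypothesis mA : measurable A.

Local Notation C := (gegenbauer l).
Local Notation J f := (\int[unif]_x f x).
Local Notation h := (heat_kernel eta l t).
Let hl : 1 <= 2 * l. Proof. by rewrite lm ler1n. Qed.
Let uA := fine (unif A).
Let delta n := \int[unif]_(x in A) gegenbauer_norm l n (dot eta x).

Let norm_continuous n : continuous (fun x : E => gegenbauer_norm l n (dot eta x)).
Proof.
apply: continuousM_fun; last exact: cst_continuous.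
exact/continuous_horner_fun/continuous_dot.
Qed.

Let norm_integrable n :
  unif.-integrable A (EFin \o (fun x => gegenbauer_norm l n (dot eta x))).
Proof.
by apply: (integrableS measurableT) => //; exact: unif_integrable_continuous.
Qed.

Lemma DeltaE n : Delta unif l n eta A = (uA + delta n)%:E.
Proof.
have i1 : unif.-integrable A (EFin \o (fun=> 1)) by exact: finite_measure_integrable_cst.
have iD : unif.-integrable A (EFin \o (fun x => 1 + gegenbauer_norm l n (dot eta x))).
  exact: (integrableD mA i1 (norm_integrable n)).
rewrite /Delta -[LHS]fineK; last exact: (integrable_fin_num mA iD).
congr EFin; rewrite -[LHS]/(\int[unif]_(x in A) (1 + gegenbauer_norm l n (dot eta x))).
by rewrite RintegralD// Rintegral_cst// mul1r.
Qed.

(** The factor C_n(1) = (2 l)_n / n! in [beta_term] cancels the normalisation of D_n. *)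
Lemma heat_term_integral n : beta_term l t n * delta n =
  J (fun x => \1_A x * heat_term eta l t n x).
Proof.
have c0 : (C n).[1] != 0 by rewrite gt_eqF// (lt_le_trans ltr01)// gegenbauer_at1_ge1.
rewrite /delta Rintegral_mkcond -RintegralZl//; last first.
  rewrite -restrict_EFin; exact: (integrable_mkcond _ mA).1.
have m1A : measurable_fun setT (\1_A : borelE R d -> R) by exact: measurable_indic.
rewrite (_ : _ \_ A = fun x => \1_A x * gegenbauer_norm l n (dot eta x)); last first.
  by apply/funext => x; rewrite patchE indicE; case: ifP => _; rewrite ?mul1r ?mul0r.
apply: ae_eq_Rintegral.
- apply: measurable_funM => //; apply: measurable_funM => //.
  exact: continuous_measurable_borelE.
- by apply: measurable_funM => //; exact: measurable_heat_term.
- apply: sub_ae (unif_ae_sphere hunif) => x Sx.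
  have S1 : \1_S x = 1 :> R by rewrite indicE mem_set.
  rewrite /heat_term S1 mul1r (beta_termE lm) /gegenbauer_norm.
  by move: (1 + n%:R / l) => w; field.
Qed.

(** Termwise integration of the series, by dominated convergence. The sum starts at 1, and the
    missing term n = 0 integrates to [uA]. *)
Lemma cvg_mixture :
  \sum_(1 <= n < N) beta_term l t n * delta n @[N --> \oo] -->
  J (fun x => \1_A x * h x) - uA.
Proof.
have m1A : measurable_fun setT (\1_A : borelE R d -> R) by exact: measurable_indic.
have mt n : measurable_fun setT (heat_term eta l t n : borelE R d -> R).
  exact: measurable_heat_term.
have hle := heat_partial_le heta hl t_gt0.
set G := heat_bound l t in hle.
have A1 (x : borelE R d) : `|\1_A x| <= 1 :> R.
  by rewrite indicE; case: (x \in A); rewrite ?normr1 ?normr0.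
have lim : J (fun x => \1_A x * series (heat_term eta l t ^~ x) N) @[N --> \oo] -->
    J (fun x => \1_A x * h x).
  apply: (@bounded_cvg_Rintegral _ _ _ unif _ _ G).
  - by move=> N; apply: measurable_funM => //; exact: measurable_heat_partial.
  - by apply: measurable_funM => //; exact: (measurable_heat_kernel heta hl t_gt0).
  - by apply: aeW => x N; rewrite normrM -[G]mul1r ler_pM// hle.
  - apply: aeW => x; apply: cvgM; [exact: cvg_cst|exact: cvg_heat_kernel].
have it n : unif.-integrable setT (EFin \o (fun x => \1_A x * heat_term eta l t n x)).
  have [M M0 hM] : exists2 M, 0 <= M & forall x, `|heat_term eta l t n x| <= M.
    have h1 := heat_term_le heta t hl n.
    by eexists; last exact: h1; rewrite (le_trans _ (h1 eta)).
  apply: (unif_integrable hunif (M := M)); first exact: measurable_funM.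
  by move=> x _; rewrite normrM -[M]mul1r ler_pM// hM.
have partialE N : (0 < N)%N ->
   \sum_(1 <= n < N) beta_term l t n * delta n =
   J (fun x => \1_A x * series (heat_term eta l t ^~ x) N) - uA.
  move=> N0.
  under [X in _ = X - _]eq_Rintegral do rewrite /series /= big_mkord mulr_sumr.
  rewrite (@Rintegral_ord_sum _ _ _ unif N (fun n x => \1_A x * heat_term eta l t n x))//.
  rewrite (eq_bigr (fun n : 'I_N => beta_term l t n * delta n)); last first.
    by move=> n _; rewrite heat_term_integral.
  rewrite -(big_mkord xpredT (fun n => beta_term l t n * delta n)) big_ltn//.
  rewrite addrAC (_ : beta_term _ _ _ * _ = uA) ?subrr ?add0r//.
  rewrite (beta_termE lm) gegenbauer0 hornerC mul0r addr0 mul1r /heat.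
  rewrite !mul0r oppr0 expR0 !mul1r /delta /gegenbauer_norm.
  under eq_Rintegral do rewrite gegenbauer0 !hornerC divr1.
  by rewrite Rintegral_cst// mul1r.
apply: (@cvg_trans _ (J (fun x => \1_A x * series (heat_term eta l t ^~ x) N) - uA @[N --> \oo])).
  apply: near_eq_cvg; near=> N; rewrite partialE//.
  by near: N; exact: nbhs_infty_gt.
by apply: cvgB; [exact: lim|exact: cvg_cst].
Unshelve. all: by end_near. Qed.

(** Strict decrease gives beta(t) > beta(t + 1) >= 0. *)
Lemma beta_gt0 : 0 < beta l t.
Proof.
apply: (@le_lt_trans _ _ (beta l (t + 1))); last first.
  by apply: (beta_decreasing lm) => //; rewrite ltrDl.
have := cvg_beta lm (addr_gt0 t_gt0 ltr01).
move=> /cvgr_to_ge; apply; apply: nearW => N.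
by apply: sumr_ge0 => n _; exact: (beta_term_ge0 lm).
Qed.

(** Each [Delta] contributes [uA] plus [delta n]. Multiplied by beta, the sum is beta [uA] plus the
    limit in [cvg_mixture], and together with (1 - beta) [uA] all multiples of [uA] cancel. *)
Lemma mixtureE :
  ((1 - beta l t)%:E * unif A
   + (beta l t)%:E * \sum_(1 <= n <oo) (br l t n)%:E * Delta unif l n eta A)%E =
  (J (fun x => \1_A x * h x))%:E.
Proof.
have b0 : beta l t != 0 by rewrite gt_eqF// beta_gt0.
have uE : unif A = uA%:E by rewrite fineK// fin_num_measure.
have lim : (\sum_(1 <= n < N) (br l t n)%:E * Delta unif l n eta A)%E @[N --> \oo] -->
   ((beta l t)^-1 * (beta l t * uA + (J (fun x => \1_A x * h x) - uA)))%:E.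
  rewrite (_ : (fun N => _) = EFin \o (fun N => (beta l t)^-1 *
     ((\sum_(1 <= n < N) beta_term l t n) * uA + \sum_(1 <= n < N) beta_term l t n * delta n))).
    apply: cvg_EFin; first exact: nearW.
    apply: cvgMr; apply: cvgD; last exact: cvg_mixture.
    by apply: cvgMl; exact: (cvg_beta lm).
  apply/funext => N /=.
  rewrite mulr_suml -big_split /= mulr_sumr -sumEFin; apply: eq_bigr => n _.
  by rewrite DeltaE /br -EFinM; congr EFin; ring.
rewrite (cvg_lim _ lim)// uE -!EFinM -EFinD; congr EFin.
by rewrite mulrA mulfV// mul1r; ring.
Qed.

End Mixture.

Unset Implicit Arguments.

Theorem theorem15 (R : realType) (d : nat) (hd : (1 < d)%N)
  (lam : R) (hlam : lam = (d%:R - 1) / 2)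
  (unif : probability (borelE R d) R) (hunif : is_unif_sphere unif)
  (dT : measure_display) (T : measurableType dT) (P : probability T R)
  (eta : 'rV[R]_d.+1) (heta : sphere R d eta)
  (B : R -> T -> 'rV[R]_d.+1) (hB : spherical_brownian_motion P eta B) :
  (exists! t0 : R, 0 < t0 /\ beta lam t0 = 1) /\
  forall t0 : R, 0 < t0 -> beta lam t0 = 1 ->
  forall t : R, t0 <= t ->
  forall A : set (borelE R d), measurable A ->
    pushforward P (B t : T -> borelE R d) A =
    ((1 - beta lam t)%:E * unif A
     + (beta lam t)%:E
       * \sum_(1 <= n <oo) (br lam t n)%:E * Delta unif lam n eta A)%E.
Proof.
have ld : 2 * lam + 1 = d%:R by rewrite hlam; field.
(* Since d > 1, 2 lam = d - 1 is a successor, the form in which Gamma values become factorials. *)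
have lm : 2 * lam = d.-2.+1%:R.
  have -> : d.-2.+1 = d.-1 by lia.
  by apply: (addIr 1); rewrite ld natr1 prednK// ltnW.
have hl : 1 <= 2 * lam by rewrite lm ler1n.
split; first exact: (beta_eq1 lm).
move=> t0 t0_gt0 _ t t0t A mA; have t_gt0 := lt_le_trans t0_gt0 t0t.
rewrite (mixtureE hunif heta lm t_gt0 mA) -(integral_heat_kernel hunif heta hl t_gt0 mA).
exact: (law_borel hunif heta hB ld hl t_gt0 mA).
Qed.
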